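(* Let $\gamma_3=1$, $\gamma_4=2$, $\gamma_5=\sqrt5$, $\gamma_6=2.25$, and let $n\in\{3,4,5,6\}$. The area of any $n$-sided convex polygon $\mathcal{P}\subseteq\mathbb{R}^2$ is bounded above by $\gamma_n$ times the maximum area of the triangles lying inside $\mathcal{P}$. Moreover, these bounds are best possible, i.e. for each $n\in\{3,4,5,6\}$ the constant $\gamma_n$ cannot be replaced by a smaller one.
   Context: A polygon is regarded as the closed region it bounds, and a triangle lies inside $\mathcal{P}$ if it is contained in this closed region (touching the boundary is allowed). *)

(* Defs.v *)
From mathcomp Require Import all_boot all_order all_algebra.
From mathcomp Require Import all_classical all_reals all_analysis.
Set Implicit Arguments.
Unset Strict Implicit.
Unset Printing Implicit Defensive.

Import Order.TTheory GRing.Theory Num.Theory.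
Import numFieldNormedType.Exports.

Local Open Scope classical_set_scope.
Local Open Scope ring_scope.

(* The regular module R^o (a copy of R) gives the product its structure of
   R-vector space. *)
Definition plane (R : realType) : lmodType R := (R^o * R^o)%type.

(* The product measure, unlike R^o, is declared on the measurable copy
   measurableTypeR R of R; all these carriers are convertible to R. *)
Definition area (R : realType) (A : set (plane R)) : \bar R :=
  (@lebesgue_measure R \x @lebesgue_measure R)%E A.

Definition convex_hull (R : realType) (A : set (plane R)) : set (plane R) :=
  smallest (@convex_set R (plane R)) A.

(* The closed region bounded by a convex polygon with exactly n vertices, hence
   n sides when 3 <= n: no vertex lies in the convex hull of the others, so the
   vertices are distinct, no three of them are collinear, and no angle is flat.
   The order in which v lists the vertices is irrelevant. *)
Definition convex_polygon (R : realType) (n : nat) (P : set (plane R)) : Prop :=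
  exists v : 'I_n -> plane R,
    (forall i, ~ convex_hull (v @` [set~ i]) (v i)) /\
    P = convex_hull (range v).

Definition triangle (R : realType) : set (set (plane R)) :=
  [set T | convex_polygon 3 T].

Definition max_triangle_area (R : realType) (P : set (plane R)) (m : \bar R) :
    Prop :=
  let areas := [set area T | T in [set T | triangle T /\ T `<=` P]] in
  areas m /\ ubound areas m.

(* The maximum m is unique when it exists; its existence is part of the claim. *)
Definition area_bound (R : realType) (n : nat) (c : R) : Prop :=
  forall P : set (plane R), convex_polygon n P ->
    exists2 m : \bar R, max_triangle_area P m & (area P <= c%:E * m)%E.

(* 0 is a junk value outside {3, 4, 5, 6}. *)
Definition gamma (R : realType) (n : nat) : R :=
  match n with
  | 3 => 1
  | 4 => 2
  | 5 => Num.sqrt 5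
  | 6 => 9 / 4
  | _ => 0
  end.

(* Main.v *)
Require Import Defs.
From mathcomp Require Import all_boot all_order all_algebra.
From mathcomp Require Import all_classical all_reals all_analysis.
From mathcomp Require Import measurable_realfun.
From mathcomp Require Import ring lra zify.
Import Order.TTheory GRing.Theory Num.Theory.
Import numFieldNormedType.Exports.
Local Open Scope ring_scope.

(** Number the vertices p0, p1, ... of a convex n-gon counterclockwise and let
    [pqr] be twice the signed area of the triangle pqr.  The function [pqr] is
    affine in each of its three arguments, so its maximum M over the polygon is
    attained at vertices: the largest triangle inside the polygon is spanned by
    three vertices and has area M / 2.  The polygon is the union of the fan of
    triangles p0 p(i+1) p(i+2), which overlap only along lines, so twice its
    area is the sum S of the numbers [p0 p(i+1) p(i+2)].  The statement becomes
    a family of polynomial inequalities: S <= gamma_n M as soon as [pqr] lies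
    in ]0, M] for all vertices p, q, r in counterclockwise order.

    For n = 3 and n = 4 the sum S has n - 2 terms, all at most M.

    For n = 5, let e_i be the area [p(i-1) p_i p(i+1)] of the ear at p_i.  Gauss'
    pentagon formula S^2 - S (sum of e_i) + (sum of e_i e_(i+1)) = 0 holds, and
    S - e_(i-1) - e_(i+1) is the triangle formed by p_i and the side opposite
    to it, hence lies in [0, M].  Measuring the e_i from (S - M) / 2, their
    common value in the regular pentagon, turns the formula into an expression
    of (5 M^2 - S^2) / 4 that is nonnegative under these constraints
    (gauss_pentagon_le).

    For n = 6, fix a triangle of area M and take barycentric coordinates with
    respect to it.  Up to rotation and reflection of the numbering there are
    three cases, according to the numbers of vertices cut off by the three
    sides of this triangle.
    - All three remaining vertices lie beyond one side: they lie in a triangle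
      of the same area, so S <= 2 M (ear_cap_le).
    - One lies beyond one side and two beyond another (side_caps_le).
    - One lies beyond each side (three_caps_le).
    In the last two cases the bound comes from adding products of the
    inequalities [pqr] <= M.  The configurations in which these are binding form
    a one-parameter family with S = (2 + h - h^2) M, and 2 + h - h^2 has
    its maximum 9/4 at h = 1/2.

    The constants are attained: by any triangle, by the square, by an affinely
    regular pentagon and, for n = 6, by a hexagon which is not affinely
    regular. *)

(** * Pentagons: the inequality behind the golden ratio *)

(** In the variables t_i = g_i + g_(i+1), the difference of the two sides of
    pentagram_sum_le becomes a quarter of this form once t_i^2 is bounded
    by t_i. *)
Definition cyc5 (R : realFieldType) (a b c d e : R) :=
  2 * (a * c + b * d + c * e + d * a + e * b)
  - 2 * (a * b + b * c + c * d + d * e + e * a) - (a + b + c + d + e).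

(** The form is affine in each variable, so it suffices to evaluate it at the
    32 vertices of the unit cube. *)
Lemma cyc5_le0 (R : realFieldType) (a b c d e : R) :
  0 <= a <= 1 -> 0 <= b <= 1 -> 0 <= c <= 1 -> 0 <= d <= 1 -> 0 <= e <= 1 ->
    cyc5 R a b c d e <= 0.
Proof.
have step (t x y z w : R) : 0 <= t <= 1 -> cyc5 R x y z w 0 <= 0 ->
  cyc5 R x y z w 1 <= 0 -> cyc5 R t x y z w <= 0.
  move=> /andP[t0 t1] h0 h1.
  have -> : cyc5 R t x y z w =
    (1 - t) * cyc5 R x y z w 0 + t * cyc5 R x y z w 1 by rewrite /cyc5; ring.
  have : 0 <= (1 - t) * - cyc5 R x y z w 0 by apply: mulr_ge0; lra.
  have : 0 <= t * - cyc5 R x y z w 1 by apply: mulr_ge0; lra.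
  lra.
by move=> *; do 5![apply: (step) => //]; rewrite /cyc5; lra.
Qed.

(** Here g_1, ..., g_5 are indexed along the pentagram, so that consecutive
    indices are vertices of the pentagon at distance two. *)
Lemma pentagram_sum_le (R : realFieldType) (g1 g2 g3 g4 g5 : R) :
  0 <= g1 + g2 -> g1 + g2 <= 1 -> 0 <= g2 + g3 -> g2 + g3 <= 1 ->
  0 <= g3 + g4 -> g3 + g4 <= 1 -> 0 <= g4 + g5 -> g4 + g5 <= 1 ->
  0 <= g5 + g1 -> g5 + g1 <= 1 ->
  g1 * g3 + g2 * g4 + g3 * g5 + g4 * g1 + g5 * g2 <= g1 + g2 + g3 + g4 + g5.
Proof.
move=> a0 a1 b0 b1 c0 c1 d0 d1 e0 e1.
pose a := g1 + g2; pose b := g2 + g3; pose c := g3 + g4; pose d := g4 + g5;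
  pose e := g5 + g1.
have sq t : 0 <= t -> t <= 1 -> t * t <= t by move=> t0 t1; rewrite ler_piMr.
have sa : a * a <= a by apply: sq.
have sb : b * b <= b by apply: sq.
have sc : c * c <= c by apply: sq.
have sd : d * d <= d by apply: sq.
have se : e * e <= e by apply: sq.
suff : 2 * (a * c + b * d + c * e + d * a + e * b)
  - 2 * (a * b + b * c + c * d + d * e + e * a) <= a + b + c + d + e.
  rewrite /a /b /c /d /e in sa sb sc sd se *; lra.
have := @cyc5_le0 R a b c d e;
  rewrite !(a0, a1, b0, b1, c0, c1, d0, d1, e0, e1) /cyc5.
by move=> /(_ isT isT isT isT isT); lra.
Qed.

(** The equation is Gauss' pentagon formula for a pentagon of area S with
    ears e_i, and the five double inequalities bound the triangles spanned by a
    vertex and the opposite side. *)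
Lemma gauss_pentagon_le (R : rcfType) (S e1 e2 e3 e4 e5 M : R) : 0 < M ->
  S ^+ 2 - S * (e1 + e2 + e3 + e4 + e5)
    + (e1 * e2 + e2 * e3 + e3 * e4 + e4 * e5 + e5 * e1) = 0 ->
  0 <= S - e1 - e3 <= M -> 0 <= S - e2 - e4 <= M ->
  0 <= S - e3 - e5 <= M -> 0 <= S - e4 - e1 <= M ->
  0 <= S - e5 - e2 <= M ->
  S <= Num.sqrt 5 * M.
Proof.
move=> M0 G T2 T3 T4 T5 T1.
have Mn0 : M != 0 by rewrite gt_eqF.
(* (S - M) / 2 is the common value of the ears when all five triangles that
   are not ears have area M. *)
pose f e := (e - (S - M) / 2) / M.
have fE e : f e * M = e - (S - M) / 2 by rewrite /f divfK.
have b e e' : 0 <= S - e - e' <= M -> 0 <= f e + f e' <= 1.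
  by move=> h; rewrite -(pmulr_lge0 _ M0) -[X in _ && X](ler_pM2r M0)
    mulrDl !fE; lra.
have H : f e1 * f e5 + f e3 * f e2 + f e5 * f e4 + f e2 * f e1 + f e4 * f e3 <=
  f e1 + f e3 + f e5 + f e2 + f e4.
  have /andP[? ?] := b _ _ T2; have /andP[? ?] := b _ _ T3;
    have /andP[? ?] := b _ _ T4.
  have /andP[? ?] := b _ _ T5; have /andP[? ?] := b _ _ T1.
  by apply: pentagram_sum_le; lra.
(* By Gauss' formula, M^2 times the difference of the two sides of H is
   (5 M^2 - S^2) / 4. *)
have S5 : S ^+ 2 <= 5 * M ^+ 2.
  have := ler_wpM2r (sqr_ge0 M) H.
  have pE e e' : f e * f e' * M ^+ 2 =
    (e - (S - M) / 2) * (e' - (S - M) / 2) by rewrite -!fE; ring.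
  have qE e : f e * M ^+ 2 = (e - (S - M) / 2) * M by rewrite -fE; ring.
  rewrite !mulrDl !pE !qE; lra.
rewrite -(ger0_norm (ltW M0)) -sqrtr_sqr -sqrtrM //.
by apply: le_trans (ler_norm _) _; rewrite -sqrtr_sqr ler_wsqrtr.
Qed.

(** * Hexagons: the polynomial inequalities *)

Section HexagonInequalities.
Variable R : realFieldType.
Implicit Types x y z i j k : R.

(** The points (b, c) = (1, 0), (b4, c4), (b5, c5), (b6, c6), (0, 0) are the
    consecutive vertices of a pentagon inside the triangle 0 <= c <= b <= 1,
    and the left-hand side is twice its area.  It is affine in (b5, c5), hence
    a convex combination, with weights 1 - b5, b5 - c5 and c5, of its values
    at the vertices of this triangle. *)
Lemma ear_cap_le (b4 c4 b5 c5 b6 c6 : R) :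
  0 <= c5 -> c4 <= 1 -> c5 <= b5 -> b5 <= 1 -> c6 <= b6 -> b6 <= 1 -> b4 <= 1 ->
  c4 + (b4 * c5 - b5 * c4) + (b5 * c6 - b6 * c5) <= 1.
Proof.
move=> c50 c41 cb5 b51 cb6 b61 b41.
have h1 : (1 - b5) * c4 <= 1 - b5 by rewrite ler_piMr // subr_ge0.
have h2 : (b5 - c5) * c6 <= b5 - c5.
  by rewrite ler_piMr // ?subr_ge0 // (le_trans cb6).
have h3 : c5 * (c6 + b4 - b6) <= c5 by rewrite ler_piMr //; lra.
lra.
Qed.

(** Let O, P, Q be the origin and the two unit points, a triangle of largest
    area.  The points are A = (p, -h), beyond OP, and U = (-u, s), V = (-v, t),
    beyond OQ, so that the hexagon is O, U, V, Q, P, A and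
    q = v (1 - s) + t u is twice the area of O, U, V, Q.  The last four
    hypotheses bound the triangles P A U, P A V, Q A U and Q A V.

    For fixed A and V the number q is affine in U, and U is confined by u <= s
    and by the triangles Q A U and P A U.  Which two of these constraints bind
    depends on the side of the line v (1 + h) = p t on which V lies; the
    products of hypotheses formed below are the resulting linear programming
    multipliers.  The triangles P A V and Q A V then take care of V. *)
Lemma side_caps_le (p h u s v t : R) :
  0 < h -> h <= p -> p <= 1 -> 0 <= u -> u <= s -> s <= 1 ->
  0 <= v -> v <= t -> t <= 1 ->
  h * (1 + u) + s * (1 - p) <= 1 -> h * (1 + v) + t * (1 - p) <= 1 ->
  u * (1 + h) + p * (1 - s) <= 1 -> v * (1 + h) + p * (1 - t) <= 1 ->
  h + (v * (1 - s) + t * u) <= 5 / 4.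
Proof.
move=> h0 hp p1 u0 us s1 v0 vt t1 c124 c125 c246 c256.
set q := _ + t * u.
have D0 : 0 < 1 + h - p by lra.
have [va|va] := leP (p * t) (v * (1 + h)).
  (* Binding for U: u <= s and the triangle Q A U. *)
  have qD : q * (1 + h - p) <= h * v + (1 - p) * t.
    have e1 : 0 <= (v * (1 + h) - p * t) * (s - u) by apply: mulr_ge0; lra.
    have e2 : 0 <= (t - v) * (1 - (u * (1 + h) + p * (1 - s))).
      by apply: mulr_ge0; lra.
    rewrite /q; nra.
  suff : q <= 1 - h ^+ 2 by have := sqr_ge0 (h - 1 / 2); lra.
  rewrite -(ler_pM2r D0).
  (* At p (1 + h) = h (2 + h) the bounds on h v + (1 - p) t given by the
     triangles P A V and Q A V coincide. *)
  have [pa|pa] := leP (p * (1 + h)) (h * (2 + h)).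
    have : 0 <= (1 - h) * ((1 + h) * (1 + h - p) - 1) by apply: mulr_ge0; lra.
    lra.
  have H1 : (h * v + (1 - p) * t) * (1 + h) <= h + (1 - p) * (1 + h).
    have : 0 <= h * (1 - (v * (1 + h) + p * (1 - t))) by apply: mulr_ge0; lra.
    have : 0 <= (1 - t) * (h * p + (1 - p) * (1 + h)).
      by apply: mulr_ge0; [lra | apply: addr_ge0; apply: mulr_ge0; lra].
    lra.
  have H2 : h + (1 - p) * (1 + h) <= (1 - h ^+ 2) * (1 + h - p) * (1 + h).
    have : 0 <= h ^+ 2 * (p * (1 + h) - h * (2 + h)) by apply: mulr_ge0; nra.
    lra.
  have h1 : 0 < 1 + h by lra.
  rewrite -(ler_pM2r h1); apply: le_trans H2; apply: le_trans H1.
  by rewrite ler_pM2r.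
have [hh|hh] := leP (h ^+ 2 + h) 1.
  (* For small h, the triangle Q A U, s <= 1 and t <= 1 are enough. *)
  have qt : q * (1 + h) <= 1.
    have : 0 <= (p * t - v * (1 + h)) * (1 - s) by apply: mulr_ge0; lra.
    have : 0 <= t * (1 - (u * (1 + h) + p * (1 - s))) by apply: mulr_ge0; lra.
    rewrite /q; nra.
  have h1 : 0 < 1 + h by lra.
  rewrite -(ler_pM2r h1).
  have [?|?] := leP h (3 / 5); nra.
(* Binding for U: the triangles P A U and Q A U. *)
have qD : q * (1 + h - p) <=
    v * ((1 + h) * (1 + h - p) - 1) + t * (1 - p + p ^+ 2 - p * h).
  have : 0 <= (p * t - v * (1 + h)) * (1 - (h * (1 + u) + s * (1 - p)))
    by apply: mulr_ge0; lra.
  have : 0 <= ((1 - p) * t + h * v) * (1 - (u * (1 + h) + p * (1 - s))).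
     by apply: mulr_ge0; [apply: addr_ge0; apply: mulr_ge0; lra|lra].
  rewrite /q; nra.
(* The triangle P A V and t <= 1 eliminate v and t. *)
have qhD : q * (1 + h - p) * h <=
    ((1 + h) * (1 + h - p) - 1) * (1 - h) + (p - h) * (1 + h - p).
  have C0 : 0 <= (1 + h) * (1 + h - p) - 1 by nra.
  have e1 : 0 <= ((1 + h) * (1 + h - p) - 1) * (1 - (h * (1 + v)
    + t * (1 - p))) by apply: mulr_ge0; lra.
  have e2 : 0 <= (p - h) * (1 + h - p) * (1 - t) by apply: mulr_ge0;
    [apply: mulr_ge0|]; lra.
  have := ler_wpM2r (ltW h0) qD.
  nra.
(* The bound on q h increases with p because (1 - h) / h <= h, so it is
   largest at p = 1; what remains is (3 h / 2 - 1)^2 >= 0. *)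
pose r := (1 - h) / h.
have rh : r * h = 1 - h by rewrite /r divfK ?gt_eqF.
have r1 : r <= h by rewrite ler_pdivrMr //; lra.
move: r rh r1 => r rh r1.
have qh : q * h <= 2 - h - h ^+ 2 - r.
  have e : 0 <= (1 - p) * (1 + h - p - r) by apply: mulr_ge0; lra.
  by rewrite -(ler_pM2r D0); lra.
have qhh := ler_wpM2r (ltW h0) qh.
have sq := sqr_ge0 (3 / 2 * h - 1).
rewrite -(ler_pM2r h0) -(ler_pM2r h0).
lra.
Qed.

(** Let A, B, C be a triangle of largest area inscribed in the hexagon
    A, P, B, Q, C, T.  With that area as unit, x, y, z are the areas of the
    caps A P B, B Q C, C T A, and the barycentric coordinates of P, Q, T are
    (1 - i, x + i, -x), (-y, 1 - j, y + j) and (z + k, -z, 1 - k).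
    Each inequality says that one of the other triangles is positively oriented
    or not larger than A B C; the last one concerns P Q T. *)
Definition caps x y z i j k : Prop :=
  [/\ [/\ 0 <= x, 0 <= y & 0 <= z], [/\ 0 <= i, 0 <= j & 0 <= k],
   [/\ i + x <= 1, j + y <= 1 & k + z <= 1],
   [/\ x + x * y + i * (y + j) <= 1,
     y + y * z + j * (z + k) <= 1 & z + z * x + k * (x + i) <= 1] &
   [/\ x * y + i * y + i * j <= i + j,
     y * z + j * z + j * k <= j + k & z * x + k * x + k * i <= k + i] /\
   x * y + y * z + z * x + i * j + j * k + k * i + i * y + j * z + k * x <=
     i + j + k].

(** The same hexagon, with A, B, C renamed cyclically. *)
Lemma caps_rotation {x y z i j k} : caps x y z i j k -> caps y z x j k i.
Proof. by case=> [][x0 y0 z0][i0 j0 k0][h1 h2 h3][h4 h5 h6][[h7 h8 h9] h];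
  split; split => //; lra. Qed.

(** The mirror image of the hexagon: A is kept, B and C are exchanged. *)
Lemma caps_reflection {x y z i j k} : caps x y z i j k ->
  caps z y x (1 - z - k) (1 - y - j) (1 - x - i).
Proof. by case=> [][x0 y0 z0][i0 j0 k0][h1 h2 h3][h4 h5 h6][[h7 h8 h9] h];
  split; split => //; try split; lra. Qed.

(** The two extra hypotheses say that T is at least as far from BC as P is, and
    P at least as far from CA as Q is.  The inequalities used are those of the
    triangles P Q T, A Q T and C P T.

    With m = 1 - i - x and d = z - m, the two hypotheses and P Q T give
    x + y + z <= 1 + d^2 / (1 + d), which is enough unless d is large (or so
    small that the claim is trivial).  For large d, eliminate j between P Q T
    and A Q T: with w = 1 - z - k and u = x w - k i this yields
    x + y + z <= 1 + x - k - u / (i + u), while C P T bounds u from below.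
    When u >= 0 the result is at most 1 + x - x^2, which reaches 5/4 at
    x = 1/2. *)
Lemma three_caps_le_aux x y z i j k : caps x y z i j k -> 1 <= i + k + z ->
  1 <= i + j + x -> x + y + z <= 5 / 4.
Proof.
case=> [][x0 y0 z0][i0 j0 k0][h1 h2 h3][_ _ c5][[_ c4 _] c7] s4 s6.
pose d := z - (1 - i - x).
have yd : y * (1 + d) <= i * (1 + d) - d.
  have : 0 <= (i + k + z - 1) * (i + j + x - 1) by apply: mulr_ge0; lra.
  rewrite /d; lra.
have [d1|d1] := leP d (- (3 / 8)).
  rewrite /d in d1; lra.
have d2 : 0 < 1 + d by lra.
(* For -3/8 <= d <= 5/8, the bound d^2 / (1 + d) is less than 1/4. *)
have [d3|d3] := leP d (5 / 8).
  have : x + y + z - 1 <= d ^+ 2 / (1 + d).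
    by rewrite ler_pdivlMr //; move: yd; rewrite /d; lra.
  suff : d ^+ 2 / (1 + d) <= 1 / 4 by lra.
  rewrite ler_pdivrMr //; nra.
pose w := 1 - z - k; pose u := x * w - k * i.
have i_gt0 : 0 < i.
  have y1d : 0 <= y * (1 + d) by apply: mulr_ge0; lra.
  by rewrite -(pmulr_lgt0 _ d2); lra.
have u5 : x ^+ 2 - k * (x + i) <= u * (1 + x).
  have : 0 <= x * (1 - (z + z * x + k * (x + i))) by apply: mulr_ge0; lra.
  by rewrite /u /w; lra.
have yu : y * (i + u) <= w * (i + u) - u.
  have : 0 <= w * (i + j + k - (x * y + y * z + z * x + i * j + j * k + k * i
    + i * y + j * z + k * x)).
    by apply: mulr_ge0; rewrite /w; lra.
  have : 0 <= (i - w) * (j + k - (y * z + j * z + j * k)).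
    by apply: mulr_ge0; rewrite /w; lra.
  by rewrite /u /w; lra.
have [u0|u0] := leP 0 u.
  suff : x + y + z <= 1 + x - x ^+ 2 by have := sqr_ge0 (x - 1 / 2); lra.
  have Du : 0 < i + u by lra.
  rewrite -(ler_pM2r Du).
  suff : 0 <= (k - x ^+ 2) * (i + u) + u by rewrite /w in yu; lra.
  have [kx|kx] := leP (x ^+ 2) k.
    apply: addr_ge0 => //; apply: mulr_ge0; lra.
  have e1 : 0 <= (x ^+ 2 - k) * (1 - i - x) by apply: mulr_ge0; lra.
  have e2 : 0 <= u * k by apply: mulr_ge0.
  have e3 : 0 <= (1 - x) * (u * (1 + x) - (x ^+ 2 - k * (x + i)))
    by apply: mulr_ge0; lra.
  have e4 : 0 <= (1 - x) * (k * (1 - x - i)) by apply: mulr_ge0;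
    [|apply: mulr_ge0]; lra.
  lra.
(* Now u < 0.  Then k >= x^2 - u (1 + x), and i + u >= d >= 5/8 leaves little
   room for - u; the products below combine into (1 - x) / 64 >= 0. *)
have iu : d <= i + u.
  have h1x : 0 < 1 + x by lra.
  by rewrite -(ler_pM2r h1x) /d; lra.
have Du : 0 < i + u by lra.
have ku : x ^+ 2 - u * (1 + x) <= k.
  have : 0 <= k * (1 - i - x) by apply: mulr_ge0; lra.
  lra.
rewrite -(ler_pM2r Du).
have e1 : 0 <= (k - (x ^+ 2 - u * (1 + x))) * (i + u) by apply: mulr_ge0; lra.
have e2 : 0 <= (x - 1 / 2) ^+ 2 * (i + u - 5 / 8) by apply: mulr_ge0;
  rewrite ?sqr_ge0 //; lra.
have e3 : 0 <= - u * (1 + x) * (i + u - 5 / 8) by do 2?apply: mulr_ge0; lra.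
have e4 : 0 <= (3 / 8 - x + u) * (3 / 8 - 5 / 8 * x) by apply: mulr_ge0; lra.
rewrite /w in yu; lra.
Qed.

(** Of the three comparisons T with P, P with Q and Q with T, two have the same
    outcome; a rotation and possibly a reflection bring them to the form
    required by three_caps_le_aux. *)
Lemma three_caps_le x y z i j k : caps x y z i j k -> x + y + z <= 5 / 4.
Proof.
move=> c; have c1 := caps_rotation c; have c2 := caps_rotation c1.
have d0 := caps_reflection c; have d1 := caps_rotation d0.
have d2 := caps_rotation d1.
have aux := three_caps_le_aux.
have [a|a] := leP 1 (i + k + z); have [b|b] := leP 1 (i + j + x);
  have [e|e] := leP 1 (j + k + y).
- by have := aux _ _ _ _ _ _ c ltac:(lra) ltac:(lra); lra.
- by have := aux _ _ _ _ _ _ c ltac:(lra) ltac:(lra); lra.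
- by have := aux _ _ _ _ _ _ c2 ltac:(lra) ltac:(lra); lra.
- by have := aux _ _ _ _ _ _ d1 ltac:(lra) ltac:(lra); lra.
- by have := aux _ _ _ _ _ _ c1 ltac:(lra) ltac:(lra); lra.
- by have := aux _ _ _ _ _ _ d0 ltac:(lra) ltac:(lra); lra.
- by have := aux _ _ _ _ _ _ d2 ltac:(lra) ltac:(lra); lra.
- by have := aux _ _ _ _ _ _ d0 ltac:(lra) ltac:(lra); lra.
Qed.

End HexagonInequalities.

Set Implicit Arguments.
Unset Strict Implicit.
Unset Printing Implicit Defensive.

Local Open Scope classical_set_scope.

(** * The area of a triangle *)

Section TriangleArea.
Variable R : realType.
Notation mR := (measurableTypeR R).

(** Twice the signed area of the triangle p q r, positive when p, q, r are in
    counterclockwise order. *)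
Definition area2 (p q r : plane R) : R :=
  (q.1 - p.1) * (r.2 - p.2) - (q.2 - p.2) * (r.1 - p.1).

(** Measurability is stated on the measurable copy of the plane used by
    area. *)
Definition plane_measurable (A : set (plane R)) : Prop :=
  measurable (A : set (mR * mR)).

Lemma integral_affine (a b c d : R) : a <= b ->
  (\int[@lebesgue_measure R]_(x in `[a, b]) (c + d * x)%:E =
   ((b - a) * ((c + d * a) + (c + d * b)) / 2)%:E)%E.
Proof.
rewrite le_eqVlt => /predU1P[<-|ab].
  by rewrite set_itv1 integral_set1 subrr !mul0r.
pose F (x : R) : R := c * x + d / 2 * x ^+ 2.
have dF (x : R) : is_derive x 1 F (c + d * x).
  by rewrite /F; apply: is_derive_eq; rewrite /GRing.scale /=; field.
rewrite (@continuous_FTC2 _ (fun x => c + d * x) F) //.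
- by rewrite -EFinB; congr EFin; rewrite /F; field.
- have cf : continuous (fun x : R => c + d * x).
    by move=> x; apply: cvgD; [exact: cvg_cst|apply: cvgM;
      [exact: cvg_cst|exact: cvg_id]].
  exact: continuous_subspaceT.
- have cF : continuous F.
    by move=> x; apply/differentiable_continuous/derivable1_diffP; case: (dF x).
  split; [by move=> x _; case: (dF x)|exact/cvg_at_right_filter/cF|
  exact/cvg_at_left_filter/cF].
- by move=> x _; rewrite derive1E; case: (dF x).
Qed.

Lemma plane_measurable_le (f g : plane R -> R) :
  measurable_fun setT (f : mR * mR -> mR) ->
    measurable_fun setT (g : mR * mR -> mR) ->
    plane_measurable [set p | f p <= g p].
Proof.
move=> mf mg; rewrite /plane_measurable -[X in measurable X]setTI;
  exact: measurable_fun_le.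
Qed.

Lemma plane_measurable_fst : measurable_fun setT (fst : mR * mR -> mR).
Proof. exact: measurable_fst. Qed.

Lemma measurable_area2 (p q : plane R)
  : measurable_fun setT (area2 p q : mR * mR -> mR).
Proof.
by apply: measurable_funB; apply: measurable_funM => //; apply: measurable_funB.
Qed.

(** A trapezoid with two vertical sides.  Its right side may be removed, so
    that two adjacent trapezoids can be made disjoint; a vertical side may
    have length zero. *)
Lemma area_slab (A : set (plane R)) (a b : R) (s : bool) (c d c' d' : R) :
  plane_measurable A -> a <= b -> c + d * a <= c' + d' * a ->
    c + d * b <= c' + d' * b ->
  A = [set p | p.1 \in Interval (BLeft a) (BSide s b) /\
               c + d * p.1 <= p.2 <= c' + d' * p.1] ->
  area A = ((b - a) * ((c' + d' * a - (c + d * a))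
    + (c' + d' * b - (c + d * b))) / 2)%:E.
Proof.
move=> mA ab ha hb AE.
rewrite /area /product_measure1.
pose f (x : R) : \bar R := ((c' - c) + (d' - d) * x)%:E.
have -> : ((c' + d' * a - (c + d * a)) + (c' + d' * b - (c + d * b))) =
  ((c' - c) + (d' - d) * a) + ((c' - c) + (d' - d) * b) by ring.
rewrite -(integral_affine _ _ ab) -/f.
transitivity (\int[@lebesgue_measure R]_(x in [set` Interval (BLeft a)
  (BSide s b)]) f x)%E.
  rewrite [RHS]integral_mkcond; apply: eq_integral => x _ /=.
  rewrite patchE; case: ifPn => [|].
    rewrite inE /= => xI.
    have -> : xsection A x = `[c + d * x, c' + d' * x]%classic.
      apply/seteqP; split => y; rewrite /xsection /= inE AE /=.
        by case=> _; rewrite in_itv.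
      by rewrite in_itv /= => h; split.
    have {}hx : c + d * x <= c' + d' * x.
      have xab : a <= x <= b.
        by move: xI; rewrite in_itv /=; case: s {AE} => /= /andP[-> //] /ltW.
      have [ea|ea] := eqVneq a b.
        by move: xab ha; rewrite -ea => /andP[? ?]; have -> : x = a by lra.
      have {}ea : 0 < b - a by lra.
      have : 0 <= (x - a) * (c' + d' * b - (c + d * b)) by apply: mulr_ge0; lra.
      have : 0 <= (b - x) * (c' + d' * a - (c + d * a)) by apply: mulr_ge0; lra.
      move=> h1 h2; rewrite -(ler_pM2l ea); lra.
    rewrite /= lebesgue_measure_itv /= lte_fin /f -EFinB.
    case: ltP => [_|h]; first by congr EFin; ring.
    by congr EFin; lra.
  rewrite notin_setE /= => xI.
  rewrite (_ : xsection A x = set0) ?measure0 //.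
  by apply/seteqP; split => // y; rewrite /xsection /= inE AE /= => -[].
have mf : measurable_fun setT (f : mR -> \bar R).
  by apply/measurable_EFinP; apply: measurable_funD => //; apply: measurable_funM.
case: s {AE} => //; apply: integral_itv_bndo_bndc; exact: measurable_funTS.
Qed.

(** The closed triangle as an intersection of half-planes; this is the triangle
    with vertices p, q, r only when area2 p q r is positive. *)
Definition tri (p q r : plane R) : set (plane R) :=
  [set x | [/\ 0 <= area2 p q x, 0 <= area2 q r x & 0 <= area2 r p x]].

Definition slope (p q : plane R) : R := (q.2 - p.2) / (q.1 - p.1).
Definition intercept (p q : plane R) : R := p.2 - slope p q * p.1.

Lemma area2_line (p q x : plane R) : p.1 < q.1 ->
  area2 p q x = (q.1 - p.1) * (x.2 - (intercept p q + slope p q * x.1)).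
Proof.
move=> pq; rewrite /area2 /intercept.
have -> : q.2 - p.2 = slope p q * (q.1 - p.1)
  by rewrite /slope divfK // subr_eq0 gt_eqF.
ring.
Qed.

Lemma area2_ge0_line (p q x : plane R) : p.1 < q.1 ->
  (0 <= area2 p q x) = (intercept p q + slope p q * x.1 <= x.2).
Proof. by move=> pq; rewrite area2_line // pmulr_rge0 ?subr_gt0 // subr_ge0. Qed.

Lemma area2C (p q x : plane R) : area2 q p x = - area2 p q x.
Proof. rewrite /area2; ring. Qed.

Lemma area2_le0_line (p q x : plane R) : p.1 < q.1 ->
  (0 <= area2 q p x) = (x.2 <= intercept p q + slope p q * x.1).
Proof. by move=> pq; rewrite area2C area2_line // oppr_ge0 pmulr_rle0 ?subr_gt0
  // subr_le0. Qed.

Lemma line_l (p q : plane R) : intercept p q + slope p q * p.1 = p.2.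
Proof. by rewrite /intercept subrK. Qed.
Lemma line_r (p q : plane R) : p.1 < q.1 -> intercept p q + slope p q * q.1 = q.2.
Proof. by move=> pq; rewrite /intercept /slope; field; rewrite subr_eq0 gt_eqF. Qed.

Lemma plane_measurable_tri (p q r : plane R) : plane_measurable (tri p q r).
Proof.
have h (p' q' : plane R) : plane_measurable [set x | 0 <= area2 p' q' x].
  by apply: (plane_measurable_le (f :=
    fun=> 0) (measurable_cst _) (measurable_area2 _ _)).
have -> : tri p q r = [set x | 0 <= area2 p q x] `&`
    [set x | 0 <= area2 q r x] `&` [set x | 0 <= area2 r p x].
  by apply/seteqP; split => x /=; [case=> ? ? ?; split|case=> [][? ?] ?; split].
by apply: measurableI; [apply: measurableI|]; apply: h.
Qed.

Lemma plane_measurable_ge1 (a : R) : plane_measurable [set x : plane R | a <= x.1].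
Proof. by apply: (plane_measurable_le (measurable_cst a) plane_measurable_fst). Qed.

Lemma plane_measurable_vline (a : R) : plane_measurable [set x : plane R | x.1 = a].
Proof.
rewrite (_ : [set x : plane R | x.1 = a] = ([set a] `*` setT)); last first.
  by apply/seteqP; split => x //=; case.
by apply: measurableX.
Qed.

Lemma plane_measurable_lt1 (a : R) : plane_measurable [set x : plane R | x.1 < a].
Proof.
rewrite (_ : [set _ | _] = ~` [set x : plane R | a <= x.1]).
  by apply: measurableC;
    apply: (plane_measurable_le (measurable_cst a) plane_measurable_fst).
by apply/seteqP; split => x /=; rewrite ltNge => /negP.
Qed.

Lemma area_vline (a : R) : area [set x : plane R | x.1 = a] = 0%E.
Proof.
rewrite (_ : [set x : plane R | x.1 = a] = ([set a] `*` setT)); last first.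
  by apply/seteqP; split => x //=; case.
by rewrite /area product_measure1E // [X in (X * _)%E](lebesgue_measure_set1 a)
  mul0e.
Qed.

End TriangleArea.

Section TriangleAreaFormula.
Variable R : realType.
Notation mR := (measurableTypeR R).
Implicit Types p q r x : plane R.

(** Gives area access to the lemmas on measures. *)
Definition areaM : {measure set (mR * mR) ->
  \bar R} := (@lebesgue_measure R \x @lebesgue_measure R)%E.

Lemma areaE (A : set (plane R)) : area A = areaM A. Proof. by []. Qed.

Lemma area_split (A : set (plane R)) (a : R) : plane_measurable A ->
  area A = (area (A `&` [set x | x.1 < a]%R) + area (A `&` [set x | a <= x.1]%R))%E.
Proof.
move=> mA; rewrite !areaE -measureU.
- congr (areaM _); rewrite -setIUr (_ : _ `|` _ = setT) ?setIT //.
  by apply/seteqP; split => // x _ /=; case: (leP a x.1); [right|left].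
- by apply: measurableI => //; apply: plane_measurable_lt1.
- by apply: measurableI => //; apply: plane_measurable_ge1.
- by apply/seteqP; split => // x /= [[_ +] [_]]; rewrite ltNge => /negP.
Qed.

(** The vertical line through the vertex whose abscissa is in the middle cuts
    the triangle into two trapezoids, with a side of length zero each.  That
    vertex is q, below the side p r, or r, above the side p q. *)
Lemma area_tri_leftmost p q r : p.1 <= q.1 -> p.1 <= r.1 -> 0 < area2 p q r ->
  area (tri p q r) = (area2 p q r / 2)%:E.
Proof.
move=> pq pr D; have D0 := ltW D.
have tri_ge x : tri p q r x -> p.1 <= x.1.
  case=> h1 h2 h3; rewrite -subr_ge0 -(pmulr_lge0 _ D).
  have -> : (x.1 - p.1) * area2 p q r =
    area2 p q x * (r.1 - p.1) + area2 r p x * (q.1 - p.1) by rewrite /area2; ring.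
  by apply: addr_ge0; apply: mulr_ge0 => //; rewrite subr_ge0.
have tri_le x m : q.1 <= m -> r.1 <= m -> tri p q r x -> x.1 <= m.
  move=> qm rm [h1 h2 h3]; rewrite -subr_ge0 -(pmulr_lge0 _ D).
  have -> : (m - x.1) * area2 p q r =
    area2 q r x * (m - p.1) + area2 p q x * (m - r.1) + area2 r p x * (m - q.1)
    by rewrite /area2; ring.
  by do 2?apply: addr_ge0; apply: mulr_ge0 => //; rewrite subr_ge0 // (le_trans pr).
have [qr|rq] := leP q.1 r.1.
  have pr' : p.1 < r.1.
    rewrite lt_neqAle pr andbT; apply/eqP => e;
      have e' : q.1 = p.1 by apply/le_anti; rewrite pq e qr.
    by move: D; rewrite /area2 -e e' !subrr mul0r mulr0 subrr ltxx.
  pose h := intercept p r + slope p r * q.1.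
  have hE : area2 p q r = (r.1 - p.1) * (h - q.2).
    rewrite (_ : area2 p q r = - area2 p r q); last by rewrite /area2; ring.
    by rewrite (area2_line _ pr') /h; ring.
  have hq : q.2 < h by move: D; rewrite hE pmulr_rgt0 ?subr_gt0 // => ?.
  rewrite (@area_split _ q.1); last exact: plane_measurable_tri.
  have -> : area (tri p q r `&` [set x | x.1 < q.1]%R) =
    ((q.1 - p.1) * (h - q.2) / 2)%:E.
    move: pq; rewrite le_eqVlt => /predU1P[e|pq'].
      rewrite e subrr !mul0r (_ : _ `&` _ = set0) ?areaE ?measure0 //.
      by apply/seteqP; split => // x [/tri_ge]; rewrite /= e leNgt => /negbTE ->.
    rewrite (@area_slab _ _ p.1 q.1 true (intercept p q) (slope p q)
      (intercept p r) (slope p r)).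
    - by rewrite !line_l line_r // -/h; congr EFin; ring.
    - by apply: measurableI;
        [apply: plane_measurable_tri|apply: plane_measurable_lt1].
    - exact: ltW.
    - by rewrite !line_l.
    - by rewrite line_r // ltW.
    apply/seteqP; split => x /=; rewrite in_itv /=.
      move=> [t xq]; have pt := tri_ge _ t; case: t => t1 t2 t3.
      by rewrite pt xq -area2_ge0_line // -area2_le0_line // t1 t3.
    rewrite -area2_ge0_line // -area2_le0_line // => -[/andP[px xq] /andP[t1 t3]].
    split => //; split => //; have qp0 : 0 < q.1 - p.1 by rewrite subr_gt0.
    rewrite -(pmulr_rge0 _ qp0).
    have -> : (q.1 - p.1) * area2 q r x =
      (r.1 - q.1) * area2 p q x + area2 p q r * (q.1 - x.1) by rewrite /area2; ring.
    by apply: addr_ge0; apply: mulr_ge0 => //; rewrite subr_ge0 // ltW.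
  have -> : area (tri p q r `&` [set x | q.1 <= x.1]%R) =
    ((r.1 - q.1) * (h - q.2) / 2)%:E.
    move: (qr); rewrite le_eqVlt => /predU1P[e|qr'].
      rewrite e subrr !mul0r; apply/eqP; rewrite eq_le; apply/andP; split;
        last by rewrite areaE.
      rewrite -[X in (_ <= X)%E](area_vline r.1) !areaE; apply: le_measure;
        rewrite ?inE.
      - apply: measurableI; [exact: plane_measurable_tri|apply:
          plane_measurable_ge1].
      - exact: plane_measurable_vline.
      by move=> x [/tri_le h1 /= h2]; apply/le_anti; rewrite h2 h1 // e.
    rewrite (@area_slab _ _ q.1 r.1 false (intercept q r) (slope q r)
      (intercept p r) (slope p r)).
    - by rewrite !line_l !line_r // -/h; congr EFin; ring.
    - by apply: measurableI;
        [apply: plane_measurable_tri|apply: plane_measurable_ge1].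
    - exact: ltW.
    - by rewrite line_l ltW.
    - by rewrite !line_r.
    apply/seteqP; split => x /=; rewrite in_itv /=.
      move=> [t xq]; have pt := tri_le _ _ qr (lexx _) t; case: t => t1 t2 t3.
      by rewrite pt xq -area2_ge0_line // -area2_le0_line // t2 t3.
    rewrite -area2_ge0_line // -area2_le0_line // => -[/andP[qx xr] /andP[t2 t3]].
    split => //; split => //; have qp0 : 0 < r.1 - q.1 by rewrite subr_gt0.
    rewrite -(pmulr_rge0 _ qp0).
    have -> : (r.1 - q.1) * area2 p q x =
      (q.1 - p.1) * area2 q r x + area2 p q r * (x.1 - q.1) by rewrite /area2; ring.
    by apply: addr_ge0; apply: mulr_ge0 => //; rewrite subr_ge0 // ltW.
  rewrite -EFinD hE; congr EFin; by field.
have pq' : p.1 < q.1 by exact: le_lt_trans pr rq.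
pose h := intercept p q + slope p q * r.1.
have hE : area2 p q r = (q.1 - p.1) * (r.2 - h) by rewrite (area2_line _ pq').
have hr : h < r.2 by move: D; rewrite hE pmulr_rgt0 ?subr_gt0 // => ?.
rewrite (@area_split _ r.1); last exact: plane_measurable_tri.
have -> : area (tri p q r `&` [set x | x.1 < r.1]%R) =
  ((r.1 - p.1) * (r.2 - h) / 2)%:E.
  move: pr; rewrite le_eqVlt => /predU1P[e|pr'].
    rewrite e subrr !mul0r (_ : _ `&` _ = set0) ?areaE ?measure0 //.
    by apply/seteqP; split => // x [/tri_ge]; rewrite /= e leNgt => /negbTE ->.
  rewrite (@area_slab _ _ p.1 r.1 true (intercept p q) (slope p q)
    (intercept p r) (slope p r)).
  - by rewrite !line_l line_r // -/h; congr EFin; ring.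
  - by apply: measurableI;
      [apply: plane_measurable_tri|apply: plane_measurable_lt1].
  - exact: ltW.
  - by rewrite !line_l.
  - by rewrite [leRHS]line_r // ltW.
  apply/seteqP; split => x /=; rewrite in_itv /=.
    move=> [t xq]; have pt := tri_ge _ t; case: t => t1 t2 t3.
    by rewrite pt xq -area2_ge0_line // -area2_le0_line // t1 t3.
  rewrite -area2_ge0_line // -area2_le0_line // => -[/andP[px xq] /andP[t1 t3]].
  split => //; split => //; have qp0 : 0 < r.1 - p.1 by rewrite subr_gt0.
  rewrite -(pmulr_rge0 _ qp0).
  have -> : (r.1 - p.1) * area2 q r x =
    (q.1 - r.1) * area2 r p x + area2 p q r * (r.1 - x.1) by rewrite /area2; ring.
  by apply: addr_ge0; apply: mulr_ge0 => //; rewrite subr_ge0 // ltW.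
have -> : area (tri p q r `&` [set x | r.1 <= x.1]%R) =
  ((q.1 - r.1) * (r.2 - h) / 2)%:E.
  rewrite (@area_slab _ _ r.1 q.1 false (intercept p q) (slope p q)
    (intercept r q) (slope r q)).
  - by rewrite !line_l !line_r // -/h; congr EFin; ring.
  - by apply: measurableI;
      [apply: plane_measurable_tri|apply: plane_measurable_ge1].
  - exact: ltW.
  - by rewrite line_l ltW.
  - by rewrite !line_r.
  apply/seteqP; split => x /=; rewrite in_itv /=.
    move=> [t xq]; have pt := tri_le _ _ (lexx _) (ltW rq) t; case: t => t1 t2 t3.
    by rewrite pt xq -area2_ge0_line // -area2_le0_line // t2 t1.
  rewrite -area2_ge0_line // -area2_le0_line // => -[/andP[qx xr] /andP[t1 t2]].
  split => //; split => //; have qp0 : 0 < q.1 - r.1 by rewrite subr_gt0.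
  rewrite -(pmulr_rge0 _ qp0).
  have -> : (q.1 - r.1) * area2 r p x =
    (r.1 - p.1) * area2 q r x + area2 p q r * (x.1 - r.1) by rewrite /area2; ring.
  by apply: addr_ge0; apply: mulr_ge0 => //; rewrite subr_ge0 // ltW.
rewrite -EFinD hE; congr EFin; by field.
Qed.

Lemma area_tri p q r : 0 < area2 p q r -> area (tri p q r) = (area2 p q r / 2)%:E.
Proof.
have rotA (a b c : plane R) : area2 b c a = area2 a b c by rewrite /area2; ring.
have rotT (a b c : plane R) : tri b c a = tri a b c.
  by apply/seteqP; split => x [? ? ?]; split.
have rot (a b c : plane R) : area (tri b c a) = (area2 b c a / 2)%:E ->
  area (tri a b c) = (area2 a b c / 2)%:E.
  by rewrite rotT rotA.
have [pq|/ltW qp] := leP p.1 q.1; have [pr|/ltW rp] := leP p.1 r.1;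
  have [qr|/ltW rq] := leP q.1 r.1 => D.
- exact: area_tri_leftmost.
- exact: area_tri_leftmost.
- by apply/rot/rot/area_tri_leftmost => //; [exact: le_trans rp pq | rewrite -rotA].
- by apply/rot/rot/area_tri_leftmost => //; rewrite -rotA.
- by apply/rot/area_tri_leftmost => //; rewrite rotA.
- by apply/rot/area_tri_leftmost => //; [exact: le_trans qp pr | rewrite rotA].
- by apply/rot/area_tri_leftmost => //; rewrite rotA.
- by apply/rot/rot/area_tri_leftmost => //; rewrite -rotA.
Qed.

End TriangleAreaFormula.

(** * Convex hulls in the plane *)

Section PlaneConvexity.
Variable R : realType.
Implicit Types (p q r x : plane R) (A B : set (plane R)).

Lemma plane_eq p q : p.1 = q.1 -> p.2 = q.2 -> p = q.
Proof. by case: p => p1 p2; case: q => q1 q2 /= -> ->. Qed.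

Lemma convexP A : convex_set A <->
  forall p q (t : R), 0 <= t -> t <= 1 -> A p -> A q ->
    A (t * p.1 + (1 - t) * q.1, t * p.2 + (1 - t) * q.2).
Proof.
split => [cA p q t t0 t1 Ap Aq | h p q t].
  have /set_mem := cA p q (Itv01 t0 t1) (mem_set Ap) (mem_set Aq).
  by move=> H; exact: H.
move=> /set_mem Ap /set_mem Aq; apply: mem_set.
exact: (h p q t%:num (ge0 t) (le1 t) Ap Aq).
Qed.

Lemma hull_convex A : convex_set (convex_hull A).
Proof.
apply/convexP => p q t t0 t1 hp hq B [/= cB AB].
by apply/(convexP B).1 => //; [apply: hp|apply: hq].
Qed.

Arguments hull_convex A : clear implicits.

Lemma hull_min A B : convex_set B -> A `<=` B -> convex_hull A `<=` B.
Proof. by move=> cB AB; apply: smallest_sub. Qed.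

Lemma sub_hull A : A `<=` convex_hull A.
Proof. exact: sub_gen_smallest. Qed.

Lemma convex_area2_ge p q (c : R) : convex_set [set x : plane R | c <= area2 p q x].
Proof.
apply/convexP => x y t t0 t1 /= hx hy.
have : 0 <= t * (area2 p q x - c) by apply: mulr_ge0; lra.
have : 0 <= (1 - t) * (area2 p q y - c) by apply: mulr_ge0; lra.
rewrite /area2 /=; lra.
Qed.

Lemma area2_swap p q r : area2 q p r = - area2 p q r.
Proof. rewrite /area2; ring. Qed.

Lemma area2_swapr p q r : area2 p r q = - area2 p q r.
Proof. rewrite /area2; ring. Qed.

Lemma area2_rot p q r : area2 q r p = area2 p q r.
Proof. rewrite /area2; ring. Qed.

Lemma convex_area2_le p q (c : R) : convex_set [set x : plane R | area2 p q x <= c].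
Proof.
rewrite (_ : [set _ | _] = [set x | - c <= area2 q p x]);
  first exact: convex_area2_ge.
by apply/seteqP; split => x /=; rewrite (area2_swap p q) lerN2.
Qed.

Lemma convex_comb3 A p q r (a b c : R) : convex_set A -> A p -> A q -> A r ->
  0 <= a -> 0 <= b -> 0 <= c -> a + b + c = 1 ->
  A (a * p.1 + b * q.1 + c * r.1, a * p.2 + b * q.2 + c * r.2).
Proof.
move=> /convexP cA Ap Aq Ar a0 b0 c0 e.
have [c1|c1] := eqVneq c 1.
  have -> : a = 0 by lra. have -> : b = 0 by lra.
  by rewrite c1 !mul0r !add0r !mul1r; case: r Ar.
have c1' : 0 < 1 - c by rewrite subr_gt0 lt_neqAle c1 /=; lra.
have aq : 0 <= a / (1 - c) by rewrite divr_ge0 // ltW.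
have aq1 : a / (1 - c) <= 1 by rewrite ler_pdivrMr //; lra.
have := cA _ _ (1 - c) (ltW c1') ltac:(lra) (cA _ _ _ aq aq1 Ap Aq) Ar.
congr A => /=; congr pair; have -> : b = 1 - c - a by lra.
- by field; rewrite gt_eqF.
- by field; rewrite gt_eqF.
Qed.

(** The barycentric coordinates of a point of the triangle are the ratios of the
    areas of the three triangles that it spans with the sides. *)
Lemma tri_sub A p q r : convex_set A -> A p -> A q -> A r ->
  0 < area2 p q r -> tri p q r `<=` A.
Proof.
move=> cA Ap Aq Ar D x [h1 h2 h3].
have Dn : area2 p q r != 0 by rewrite gt_eqF.
have := @convex_comb3 A p q r (area2 q r x / area2 p q r)
  (area2 r p x / area2 p q r)
  (area2 p q x / area2 p q r) cA Ap Aq Ar.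
rewrite !divr_ge0 ?(ltW D) // => /(_ isT isT isT).
rewrite -!mulrDl (_ : _ + _ = area2 p q r); last by rewrite /area2; ring.
rewrite divff // => /(_ erefl); congr A; apply: plane_eq => /=.
- rewrite ![_ / _ * _]mulrAC -!mulrDl; apply: (mulIf Dn);
    rewrite divfK // /area2; ring.
- rewrite ![_ / _ * _]mulrAC -!mulrDl; apply: (mulIf Dn);
    rewrite divfK // /area2; ring.
Qed.

(** Each argument is moved in turn: for fixed p and q, the points x with
    area2 p q x <= M form a half-plane, which contains the hull of A as soon as
    it contains A. *)
Lemma hull_area2_le A (M : R) :
  (forall p q r, A p -> A q -> A r -> area2 p q r <= M) ->
  forall p q r, convex_hull A p -> convex_hull A q -> convex_hull A r ->
    area2 p q r <= M.
Proof.
move=> h.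
have h1 p q r : A p -> A q -> convex_hull A r -> area2 p q r <= M.
  move=> Ap Aq; apply: (@hull_min A [set r | area2 p q r <= M]);
    first exact: convex_area2_le.
  by move=> x Ax; apply: h.
have h2 p q r : A p -> convex_hull A q -> convex_hull A r -> area2 p q r <= M.
  move=> Ap + Ar; rewrite -area2_rot -area2_rot.
  apply: (@hull_min A [set q | area2 r p q <= M]); first exact: convex_area2_le.
  by move=> x Ax /=; rewrite -area2_rot; apply: h1.
move=> p q r + Aq Ar; rewrite -area2_rot.
apply: (@hull_min A [set p | area2 q r p <= M]); first exact: convex_area2_le.
by move=> x Ax /=; rewrite area2_rot; apply: h2.
Qed.

(** * Counterclockwise order of the vertices *)

Definition ccw n (p : nat -> plane R) :=
  forall i j k, (i < j < k)%N -> (k < n)%N -> 0 < area2 (p i) (p j) (p k).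

Definition convex_position n (v : 'I_n -> plane R) :=
  forall i, ~ convex_hull (v @` [set~ i]) (v i).

(** The points q with lexlt p q form half of the punctured plane around p, on
    which comparing directions from p is a total preorder. *)
Definition lexlt p q := p.1 < q.1 \/ (p.1 = q.1 /\ p.2 < q.2).

Lemma lexlt_trans o p q r : lexlt o p -> lexlt o q -> lexlt o r ->
  0 <= area2 o p q -> 0 <= area2 o q r -> 0 <= area2 o p r.
Proof.
rewrite /lexlt /area2 => hp hq hr pq qr.
have p0 : 0 <= p.1 - o.1 by case: hp => [|[]]; lra.
have r0 : 0 <= r.1 - o.1 by case: hr => [|[]]; lra.
case: hq => [q1|[q1 q2]].
  rewrite -(pmulr_rge0 _ (_ : 0 < q.1 - o.1)) ?subr_gt0 //.
  have := addr_ge0 (mulr_ge0 p0 qr) (mulr_ge0 r0 pq).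
  by congr (0 <= _); ring.
case: hr => [r1|[r1 r2]].
  have : 0 < (q.2 - o.2) * (r.1 - o.1) by apply: mulr_gt0; lra.
  by move: qr; rewrite -q1; lra.
by rewrite -r1 subrr mulr0 subr0; apply: mulr_ge0; lra.
Qed.

Lemma lexlt_collinear o p q : lexlt o p -> lexlt o q -> area2 o p q = 0 ->
  exists2 t, 0 <= t & p.1 - o.1 = t * (q.1 - o.1) /\ p.2 - o.2 = t * (q.2 - o.2).
Proof.
rewrite /lexlt /area2 => hp [q1|[q1 q2]] e.
  have q10 : q.1 - o.1 != 0 by rewrite subr_eq0 gt_eqF.
  exists ((p.1 - o.1) / (q.1 - o.1)).
    by apply: divr_ge0; case: hp => [|[]]; lra.
  split; first by rewrite divfK.
  apply: (mulIf q10); rewrite [RHS]mulrAC divfK //; lra.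
have q20 : q.2 - o.2 != 0 by rewrite subr_eq0 gt_eqF.
have p1 : p.1 - o.1 = 0 by apply: (mulIf q20); rewrite mul0r;
  rewrite -q1 in e *; lra.
exists ((p.2 - o.2) / (q.2 - o.2)).
  by apply: divr_ge0; case: hp => [|[]]; lra.
by rewrite divfK // -q1 subrr mulr0; split.
Qed.

Lemma convex_between A o q p (t : R) : convex_set A -> A o -> A q -> 0 <= t ->
  t <= 1 ->
  p.1 - o.1 = t * (q.1 - o.1) -> p.2 - o.2 = t * (q.2 - o.2) -> A p.
Proof.
move=> /convexP cA Ao Aq t0 t1 e1 e2; have := cA _ _ _ t0 t1 Aq Ao.
by congr A; apply: plane_eq => /=; lra.
Qed.

Section CcwOrdering.
Variables (n : nat) (v : 'I_n -> plane R).
Hypothesis cv : convex_position v.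

Lemma hull_other_vertex i j : j != i -> convex_hull (v @` [set~ i]) (v j).
Proof. by move=> ji; apply: sub_hull; exists j => //=; apply/eqP. Qed.

Lemma convex_position_neq0 o i j : i != o -> j != o -> i != j ->
  lexlt (v o) (v i) -> lexlt (v o) (v j) ->
  area2 (v o) (v i) (v j) != 0.
Proof.
move=> io jo ij li lj; apply/eqP => e.
have [t t0 [e1 e2]] := lexlt_collinear li lj e.
have [t1|t1] := leP t 1.
  apply: (cv (i := i)); apply: (@convex_between _ (v o) (v j)
    _ t (hull_convex _)) => //.
  - by apply: hull_other_vertex; rewrite eq_sym.
  - by apply: hull_other_vertex; rewrite eq_sym.
have tn0 : t != 0 by rewrite gt_eqF //; lra.
apply: (cv (i := j)); apply: (@convex_between _ (v o) (v i) _ t^-1 (hull_convex _)).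
- by apply: hull_other_vertex; rewrite eq_sym.
- exact: hull_other_vertex.
- by rewrite invr_ge0.
- by rewrite invf_le1 ?ltW //; lra.
- by rewrite e1 mulKf.
- by rewrite e2 mulKf.
Qed.

Lemma exists_lexmin : 'I_n -> exists o, forall i, i != o -> lexlt (v o) (v i).
Proof.
move=> i0.
case: (Order.TotalTheory.arg_minP (fun i => (v i).1 : R) (isT : xpredT i0))
  => i1 _ h1.
case: (Order.TotalTheory.arg_minP (fun i => (v i).2 : R)
  (eqxx (v i1).1 : [pred i | (v i).1 == (v i1).1] i1)) => o /eqP eo h2.
exists o => i io; rewrite /lexlt.
have := h1 i isT; rewrite -eo le_eqVlt => /predU1P[e|]; last by left.
right; split => //; rewrite lt_neqAle h2 ?andbT //=; last by rewrite -e eo.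
apply/eqP => e2; apply: (cv (i := i)).
rewrite -(plane_eq e e2); by apply: hull_other_vertex; rewrite eq_sym.
Qed.

(** Sort the other vertices by direction around the lexicographically smallest
    one.  Triangles at that vertex are then positively oriented, and another
    triangle with the wrong orientation would put its middle vertex inside the
    hull of the others. *)
Lemma ccw_ordering : (0 < n)%N ->
  exists2 p, ccw n p & p @` [set k | (k < n)%N] = range v.
Proof.
move=> n0; case: (exists_lexmin (Ordinal n0)) => o ho.
pose leT i j := 0 <= area2 (v o) (v i) (v j).
pose P := [pred i : 'I_n | i != o].
pose s := sort leT (enum P).
have sP i : (i \in s) = (i != o) by rewrite mem_sort mem_enum.
have aP : all P s by apply/allP => i; rewrite sP.
have us : uniq s by rewrite sort_uniq enum_uniq.
have ss : size s = n.-1.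
  by rewrite size_sort -cardE cardC1 card_ord.
have tot : total leT.
  by move=> i j; rewrite /leT (area2_swapr (v o) (v i) (v j)) oppr_ge0 le_total.
have pw : pairwise leT s.
  rewrite -(@sorted_pairwise_in _ P) //; first exact: sort_sorted.
  move=> j i k; rewrite !inE => jo io ko; apply: lexlt_trans; exact: ho.
pose p k := if k is k'.+1 then v (nth o s k') else v o.
have pS i j : (0 < i < j)%N -> (j < n)%N -> 0 < area2 (p 0%N) (p i) (p j).
  case: i j => [|i] [|j] //=; rewrite ltnS => ij jn.
  have js : (j < size s)%N by rewrite ss; case: n jn.
  have is_ : (i < size s)%N by apply: ltn_trans js.
  have io : nth o s i != o by rewrite -sP mem_nth.
  have jo : nth o s j != o by rewrite -sP mem_nth.
  rewrite lt_neqAle eq_sym; apply/andP; split.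
    apply: convex_position_neq0 => //; try exact: ho.
    by rewrite nth_uniq // neq_ltn ij.
  by have /(pairwiseP o) := pw; apply.
exists p.
  move=> i j k /andP[ij jk] kn; case: i ij => [|i] ij; first by apply: pS;
    rewrite ?ij.
  have [//|D] := ltP 0 (area2 (p i.+1) (p j) (p k)).
  exfalso.
  have : exists2 l : 'I_n, p j = v l & [/\ convex_hull (v @` [set~ l]) (p 0%N),
    convex_hull (v @` [set~ l]) (p i.+1) & convex_hull (v @` [set~ l]) (p k)].
    case: j ij jk D => // j ij; case: k kn => // k kn;
      rewrite !ltnS in ij * => jk D.
    have ks : (k < size s)%N by rewrite ss; case: n kn.
    have js : (j < size s)%N by apply: ltn_trans ks.
    have is_ : (i < size s)%N by apply: ltn_trans js.
    exists (nth o s j) => //; split; apply: hull_other_vertex => /=.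
    - by rewrite eq_sym -sP mem_nth.
    - by rewrite nth_uniq // neq_ltn ij.
    - by rewrite nth_uniq // neq_ltn jk orbT.
  case=> l e [h0 hi hk]; apply: (cv (i := l)); rewrite -e.
  have D1 := pS _ _ (_ : (0 < i.+1 < k)%N) kn.
  apply: (tri_sub (hull_convex _) h0 hi hk (D1 (ltn_trans ij jk))).
  have jn := ltn_trans jk kn.
  split.
  - exact/ltW/pS.
  - by rewrite area2_swapr oppr_ge0.
  - by rewrite -area2_rot; apply/ltW/pS => //; rewrite jk (ltn_trans _ ij).
apply/seteqP; split => x /=.
  by case=> -[|k] _ <-; [exists o|exists (nth o s k)].
case=> i _ <-; have [->|io] := eqVneq i o; first by exists 0%N.
exists (index i s).+1; last by rewrite /= nth_index // sP.
by rewrite /= -ltn_predRL -ss index_mem sP.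
Qed.
End CcwOrdering.

End PlaneConvexity.

(** * The fan triangulation *)

Section Fan.
Variable R : realType.
Notation mR := (measurableTypeR R).
Implicit Types (q r x : plane R) (A B : set (plane R)) (p : nat -> plane R).

Definition line (q r : plane R) := [set x : plane R | area2 q r x = 0].

Lemma plane_measurable_line q r : plane_measurable (line q r).
Proof.
have -> : line q r = [set x | 0 <= area2 q r x] `&` [set x | area2 q r x <= 0].
  apply/seteqP; split => x /=; first by rewrite /line /= => ->.
  by case=> h1 h2; apply/le_anti; rewrite h1 h2.
apply: measurableI.
  by apply: (plane_measurable_le (f :=
    fun=> 0) (measurable_cst _) (measurable_area2 _ _)).
by apply: (plane_measurable_le (g :=
  fun=> 0) (measurable_area2 _ _) (measurable_cst _)).
Qed.

Lemma area_line q r : q <> r -> area (line q r) = 0%E.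
Proof.
move=> qr; have [e1|n1] := eqVneq q.1 r.1.
  have n2 : r.2 - q.2 != 0.
    by rewrite subr_eq0; apply/eqP => e2; apply: qr; apply: plane_eq.
  rewrite -(area_vline q.1); congr area; apply/seteqP; split => x.
    rewrite /line /area2 /= -e1 subrr mul0r sub0r => /eqP.
    by rewrite oppr_eq0 mulf_eq0 (negPf n2) /= subr_eq0 => /eqP.
  by rewrite /line /area2 /= => ->; rewrite -e1 subrr mul0r mulr0 subrr.
rewrite /area /product_measure1 -[RHS](integral0 (@lebesgue_measure R) setT).
apply: eq_integral => x _ /=.
rewrite (_ : xsection _ _ =
  [set q.2 + (r.2 - q.2) / (r.1 - q.1) * (x - q.1)]) ?lebesgue_measure_set1 //.
have d0 : r.1 - q.1 != 0 by rewrite subr_eq0 eq_sym.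
apply/seteqP; split => y; rewrite /xsection /line /area2 /= inE /= => h.
  by apply: (mulfI d0); rewrite mulrDr mulrA (mulrCA _ (r.2 - q.2))
    mulfV // mulr1; lra.
by rewrite h; field.
Qed.

Lemma areaU_null A B C : plane_measurable A -> plane_measurable B ->
  plane_measurable C -> area C = 0%E -> A `&` B `<=` C -> (area A < +oo)%E ->
  area (A `|` B) = (area A + area B)%E.
Proof.
move=> mA mB mC C0 AB Af; rewrite !areaE measureUfinl //.
rewrite (_ : areaM R (A `&` B) = 0%E) ?sube0 //.
apply/eqP; rewrite eq_le measure_ge0 andbT.
rewrite -[X in (_ <= X)%E]C0 areaE; apply: le_measure; rewrite ?inE //.
exact: measurableI.
Qed.

Definition fan p k : set (plane R) :=
  \big[setU/set0]_(i < k) tri (p 0%N) (p i.+1) (p i.+2).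
Definition fan_area2 p k : R := \sum_(i < k) area2 (p 0%N) (p i.+1) (p i.+2).

Lemma plane_measurable_fan p k : plane_measurable (fan p k).
Proof. by apply: bigsetU_measurable => i _; apply: plane_measurable_tri. Qed.

(** The line through p 0 and p (k + 1) separates the first k triangles of the
    fan from the next one, which therefore meets them in a null set. *)
Lemma fan_le n p k x : ccw n p -> (k.+1 < n)%N -> fan p k x ->
  area2 (p 0%N) (p k.+1) x <= 0.
Proof.
move=> cp kn; rewrite /fan -(bigcup_mkord k (fun i => tri (p 0%N) (p i.+1)
  (p i.+2))) => -[i /= ik [h1 h2 h3]].
have ik1 : (i.+2 <= k.+1)%N by [].
have D : 0 < area2 (p 0%N) (p i.+1) (p i.+2) by apply: cp;
  [rewrite /= ltnSn|apply: leq_ltn_trans kn].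
rewrite -(pmulr_rle0 _ D).
have -> : area2 (p 0%N) (p i.+1) (p i.+2) * area2 (p 0%N) (p k.+1) x =
  - (area2 (p i.+2) (p 0%N) x * area2 (p 0%N) (p i.+1) (p k.+1) + area2 (p 0%N)
      (p i.+1) x * area2 (p 0%N) (p i.+2) (p k.+1)) by rewrite /area2; ring.
rewrite oppr_le0; apply: addr_ge0; apply: mulr_ge0 => //;
  first by apply/ltW/cp; rewrite /= ?ltnS.
move: ik1; rewrite leq_eqVlt => /predU1P[->|?]; last by apply/ltW/cp.
by rewrite (_ : area2 _ _ _ = 0) // /area2; ring.
Qed.

Lemma area_fan n p k : ccw n p -> (k.+1 < n)%N ->
  area (fan p k) = (fan_area2 p k / 2)%:E.
Proof.
move=> cp; elim: k => [|k IH] kn.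
  by rewrite /fan /fan_area2 !big_ord0 mul0r areaE measure0.
have {}IH := IH (ltnW kn).
have D : 0 < area2 (p 0%N) (p k.+1) (p k.+2) by apply: cp; rewrite /= ?ltnSn.
rewrite /fan /fan_area2 !big_ord_recr /= -/(fan p k) -/(fan_area2 p k).
rewrite (@areaU_null _ _ (line (p 0%N) (p k.+1))).
- by rewrite IH area_tri // -EFinD -mulrDl.
- exact: plane_measurable_fan.
- exact: plane_measurable_tri.
- exact: plane_measurable_line.
- by apply: area_line => e; move: D; rewrite -e /area2 !subrr !mul0r subrr ltxx.
- by move=> x [/(fan_le cp (ltnW kn)) h1 [h2 _ _]]; apply/le_anti; rewrite h1 h2.
- by rewrite IH ltry.
Qed.

Lemma ccw_edge n p i j : ccw n p -> (i.+1 < n)%N -> (j < n)%N ->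
  0 <= area2 (p i) (p i.+1) (p j).
Proof.
move=> cp iN jn; have [ji|ij] := ltnP j i.
  by rewrite -area2_rot -area2_rot; apply/ltW/cp => //; rewrite ji ltnSn.
move: ij; rewrite leq_eqVlt => /predU1P[->|].
  by rewrite (_ : area2 _ _ _ = 0) // /area2; ring.
rewrite leq_eqVlt => /predU1P[->|ij].
  by rewrite (_ : area2 _ _ _ = 0) // /area2; ring.
by apply/ltW/cp => //; rewrite ltnSn.
Qed.

Lemma ccw_last_edge n p j : ccw n.+1 p -> (j < n.+1)%N ->
  0 <= area2 (p n) (p 0%N) (p j).
Proof.
move=> cp; rewrite ltnS leq_eqVlt => /predU1P[->|jn].
  by rewrite (_ : area2 _ _ _ = 0) // /area2; ring.
case: j jn => [|j] jn.
  by rewrite (_ : area2 _ _ _ = 0) // /area2; ring.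
by rewrite -area2_rot; apply/ltW/cp.
Qed.

Definition ngon n p := convex_hull (p @` [set k | (k < n)%N]).

(** A point of the hull is to the left of all sides.  Seen from p 0, it lies
    between two consecutive vertices p (k + 1) and p (k + 2), since it is to
    the left of the first side and of the last one; hence it lies in the
    corresponding triangle of the fan. *)
Lemma ngonE n p : ccw n.+3 p -> ngon n.+3 p = fan p n.+1.
Proof.
move=> cp; apply/seteqP; split; last first.
  rewrite /fan -(bigcup_mkord _ (fun i => tri (p 0%N) (p i.+1) (p i.+2)))
    => x [i /= ik].
  have mem j : (j < n.+3)%N -> ngon n.+3 p (p j) by move=> jn; apply: sub_hull;
    exists j.
  apply: (tri_sub (A := ngon n.+3 p)); first exact: hull_convex.
  - exact: mem.
  - by apply: mem; rewrite ltnS ltnW.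
  - by apply: mem.
  - by apply: cp; rewrite /= ?ltnSn.
move=> x hx.
have edge i : (i.+1 < n.+3)%N -> 0 <= area2 (p i) (p i.+1) x.
  move=> iN; move: hx.
  apply: (@hull_min _ _ [set x | 0 <= area2 (p i) (p i.+1) x]).
    exact: convex_area2_ge.
  by move=> _ [j /= jn <-] /=; apply: ccw_edge cp _ _.
have last_edge : 0 <= area2 (p n.+2) (p 0%N) x.
  move: hx; apply: (@hull_min _ _ [set x | 0 <= area2 (p n.+2) (p 0%N) x]);
    first exact: convex_area2_ge.
  by move=> _ [j /= jn <-] /=; apply: ccw_last_edge cp _.
have h k : (k <= n)%N -> area2 (p 0%N) (p k.+2) x <= 0 -> fan p k.+1 x.
  elim: k => [|k IH] kn hk; rewrite /fan big_ord_recr /=.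
    by right; split; [exact: edge|exact: edge|rewrite area2_swap oppr_ge0].
  have [h0|h0] := leP (area2 (p 0%N) (p k.+2) x) 0.
    by left; apply: IH => //; exact: ltnW.
  right; split; [exact: ltW|by apply: edge|by rewrite area2_swap oppr_ge0].
by apply: h => //; rewrite area2_swap oppr_le0.
Qed.

(** The line through the two neighbours of a vertex separates it from all the
    other vertices. *)
Lemma ngon_convex_polygon n p : ccw n.+3 p -> convex_polygon n.+3 (ngon n.+3 p).
Proof.
move=> cp; exists (fun i : 'I_n.+3 => p i); split; last first.
  congr convex_hull; apply/seteqP; split => x /=.
    by move=> [k kn <-]; exists (Ordinal kn).
  by move=> [i _ <-]; exists i => /=.
pose prev (i : nat) := if i is i'.+1 then p i' else p n.+2.
pose next (i : nat) := if (i.+1 < n.+3)%N then p i.+1 else p 0%N.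
have Dn (i : nat) : (i < n.+3)%N -> area2 (prev i) (next i) (p i) < 0.
  move=> iN; rewrite area2_swapr oppr_lt0 /prev /next; case: i iN => [|i] iN.
    by rewrite -area2_rot; apply: cp.
  by case: ifPn => iN1; [apply: cp; lia|rewrite -area2_rot -area2_rot;
    apply: cp; lia].
have Dp (i j : nat) : (i < n.+3)%N -> (j < n.+3)%N -> j != i ->
  0 <= area2 (prev i) (next i) (p j).
  have e1 (q r : plane R) : area2 q r q = 0 by rewrite /area2; ring.
  have e2 (q r : plane R) : area2 q r r = 0 by rewrite /area2; ring.
  rewrite /prev /next; case: i => [|i] iN jN ji.
    have [->|j1] := eqVneq j 1%N; first by rewrite e2.
    have [->|jn] := eqVneq j n.+2; first by rewrite e1.
    rewrite -area2_rot; apply/ltW/cp => //; lia.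
  have [->|j1] := eqVneq j i; first by rewrite e1.
  case: ifPn => iN1.
    have [->|jn] := eqVneq j i.+2; first by rewrite e2.
    have [ij|ij] := ltnP i j; first by apply/ltW/cp; lia.
    by rewrite -area2_rot -area2_rot; apply/ltW/cp; lia.
  have [->|jn] := eqVneq j 0%N; first by rewrite e2.
  by rewrite -area2_rot; apply/ltW/cp; lia.
move=> i hi; have := Dn i (ltn_ord i); apply/negP; rewrite -leNgt.
move: hi; apply: (@hull_min _ _ [set x | 0 <= area2 (prev i) (next i) x]);
  first exact: convex_area2_ge.
move=> _ [j /= ji <-]; apply: Dp => //; by apply/eqP => /val_inj.
Qed.

End Fan.

(** * From vertices to barycentric coordinates *)

Section HexagonCases.
Variable R : realType.
Implicit Types (a b c q r x : plane R) (p : nat -> plane R) (M : R).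

(** The determinant of the barycentric coordinates of three points is the ratio
    of the area of their triangle to that of the reference triangle. *)
Lemma area2_bary a b c q r x : area2 a b c ^+ 2 * area2 q r x =
  area2 b c q * (area2 c a r * area2 a b x - area2 a b r * area2 c a x)
  - area2 c a q * (area2 b c r * area2 a b x - area2 a b r * area2 b c x)
  + area2 a b q * (area2 b c r * area2 c a x - area2 c a r * area2 b c x).
Proof. by rewrite /area2; ring. Qed.

Definition det3 (a1 b1 c1 a2 b2 c2 a3 b3 c3 : R) : R :=
  a1 * (b2 * c3 - c2 * b3) - b1 * (a2 * c3 - c2 * a3) + c1 * (a2 * b3 - b2 * a3).

Definition triples_bounded n p M :=
  forall i j k, (i < j < k)%N -> (k < n)%N -> 0 < area2 (p i) (p j) (p k) <= M.

Definition coord (a b q : plane R) M := area2 a b q / M.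

Lemma coord_sum a b c q : area2 a b c != 0 ->
  coord b c q (area2 a b c) + coord c a q (area2 a b c)
    + coord a b q (area2 a b c) = 1.
Proof.
move=> D; rewrite /coord -!mulrDl (_ : _ + _ = area2 a b c) ?divff //.
by rewrite /area2; ring.
Qed.

Lemma area2_det3 a b c q r x M : area2 a b c = M -> M != 0 ->
  area2 q r x = M * det3 (coord b c q M) (coord c a q M) (coord a b q M)
    (coord b c r M) (coord c a r M) (coord a b r M)
    (coord b c x M) (coord c a x M) (coord a b x M).
Proof.
move=> MD Mn; have := area2_bary a b c q r x; rewrite MD /det3 /coord.
by move=> /(canRL (mulKf (expf_neq0 2 Mn))) ->; field.
Qed.

Lemma coord1 a b c M : area2 a b c = M -> M != 0 -> coord b c a M = 1.
Proof. by move=> <- D; rewrite /coord area2_rot divff. Qed.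
Lemma coord0l a b M : coord a b a M = 0.
Proof. by rewrite /coord (_ : area2 _ _ _ = 0) ?mul0r // /area2; ring. Qed.
Lemma coord0r a b M : coord a b b M = 0.
Proof. by rewrite /coord (_ : area2 _ _ _ = 0) ?mul0r // /area2; ring. Qed.

(** In the next three lemmas, al, be and ga are the barycentric coordinates with
    respect to a triangle of largest area.  Each hypothesis of the polynomial
    inequality is then the bound on one triple of vertices, read in these
    coordinates. *)
Lemma hexagon_le_alternate p :
  triples_bounded 6 p (area2 (p 0%N) (p 2%N) (p 4%N)) ->
  fan_area2 p 4 <= 9 / 4 * area2 (p 0%N) (p 2%N) (p 4%N).
Proof.
set M := area2 _ _ _ => bd.
have /andP[M0 _] : 0 < M <= M by apply: bd.
have Mn : M != 0 by rewrite gt_eqF.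
pose al q := coord (p 2%N) (p 4%N) q M.
pose be q := coord (p 4%N) (p 0%N) q M.
pose ga q := coord (p 0%N) (p 2%N) q M.
have sum q : al q + be q + ga q = 1 := coord_sum q Mn.
have D q r x : area2 q r x =
  M * det3 (al q) (be q) (ga q) (al r) (be r) (ga r) (al x) (be x) (ga x) :=
  area2_det3 q r x (erefl M) Mn.
have H i j k : (i < j < k)%N -> (k < 6)%N ->
    0 < det3 (al (p i)) (be (p i)) (ga (p i)) (al (p j)) (be (p j)) (ga (p j))
             (al (p k)) (be (p k)) (ga (p k)) <= 1.
  by move=> ijk kn; rewrite -(pmulr_rgt0 _ M0) -[X in _ && X](ler_pM2l M0)
    -D mulr1 bd.
have [a0 b0 c0] : [/\ al (p 0%N) = 1, be (p 0%N) = 0 & ga (p 0%N) = 0].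
  by split; [apply: coord1|exact: coord0r|exact: coord0l].
have [a2 b2 c2] : [/\ al (p 2%N) = 0, be (p 2%N) = 1 & ga (p 2%N) = 0].
  by split; [exact: coord0l|apply: coord1; rewrite // area2_rot|exact: coord0r].
have [a4 b4 c4] : [/\ al (p 4%N) = 0, be (p 4%N) = 0 & ga (p 4%N) = 1].
  by split; [exact: coord0r|exact: coord0l|apply: coord1; rewrite // -area2_rot].
have e1 : be (p 1%N) = 1 - al (p 1%N) - ga (p 1%N) by have := sum (p 1%N); lra.
have e3 : ga (p 3%N) = 1 - al (p 3%N) - be (p 3%N) by have := sum (p 3%N); lra.
have e5 : al (p 5%N) = 1 - be (p 5%N) - ga (p 5%N) by have := sum (p 5%N); lra.
have vv := (a0, b0, c0, a2, b2, c2, a4, b4, c4, e1, e3, e5).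
have c : caps R (- ga (p 1%N)) (- al (p 3%N)) (- be (p 5%N))
    (1 - al (p 1%N)) (1 - be (p 3%N)) (1 - ga (p 5%N)).
  split; [split|split|split|split|split; first split].
  - by have /andP[] := H 0%N 1%N 2%N isT isT; rewrite /det3 !vv; lra.
  - by have /andP[] := H 2%N 3%N 4%N isT isT; rewrite /det3 !vv; lra.
  - by have /andP[] := H 0%N 4%N 5%N isT isT; rewrite /det3 !vv; lra.
  - by have /andP[] := H 1%N 2%N 4%N isT isT; rewrite /det3 !vv; lra.
  - by have /andP[] := H 0%N 3%N 4%N isT isT; rewrite /det3 !vv; lra.
  - by have /andP[] := H 0%N 2%N 5%N isT isT; rewrite /det3 !vv; lra.
  - by have /andP[] := H 0%N 1%N 4%N isT isT; rewrite /det3 !vv; lra.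
  - by have /andP[] := H 0%N 2%N 3%N isT isT; rewrite /det3 !vv; lra.
  - by have /andP[] := H 2%N 4%N 5%N isT isT; rewrite /det3 !vv; lra.
  - by have /andP[] := H 0%N 1%N 3%N isT isT; rewrite /det3 !vv; lra.
  - by have /andP[] := H 2%N 3%N 5%N isT isT; rewrite /det3 !vv; lra.
  - by have /andP[] := H 1%N 4%N 5%N isT isT; rewrite /det3 !vv; lra.
  - by have /andP[] := H 1%N 3%N 4%N isT isT; rewrite /det3 !vv; lra.
  - by have /andP[] := H 0%N 3%N 5%N isT isT; rewrite /det3 !vv; lra.
  - by have /andP[] := H 1%N 2%N 5%N isT isT; rewrite /det3 !vv; lra.
  - by have /andP[] := H 1%N 3%N 5%N isT isT; rewrite /det3 !vv; lra.
have -> : fan_area2 p 4 = M * (1 - ga (p 1%N) - al (p 3%N) - be (p 5%N)).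
  rewrite (_ : fan_area2 p 4 =
    area2 (p 0%N) (p 1%N) (p 2%N) + area2 (p 0%N) (p 2%N) (p 4%N) +
    area2 (p 2%N) (p 3%N) (p 4%N) + area2 (p 0%N) (p 4%N) (p 5%N)).
    by rewrite !D /det3 !vv; ring.
  by rewrite /fan_area2 !big_ord_recr big_ord0 /= /area2; ring.
by rewrite mulrC ler_pM2r //; have := three_caps_le _ _ _ _ _ _ _ c; lra.
Qed.

Lemma hexagon_le_side p : triples_bounded 6 p (area2 (p 0%N) (p 2%N) (p 5%N)) ->
  fan_area2 p 4 <= 9 / 4 * area2 (p 0%N) (p 2%N) (p 5%N).
Proof.
set M := area2 _ _ _ => bd.
have /andP[M0 _] : 0 < M <= M by apply: bd.
have Mn : M != 0 by rewrite gt_eqF.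
pose al q := coord (p 2%N) (p 5%N) q M.
pose be q := coord (p 5%N) (p 0%N) q M.
pose ga q := coord (p 0%N) (p 2%N) q M.
have sum q : al q + be q + ga q = 1 := coord_sum q Mn.
have D q r x : area2 q r x =
  M * det3 (al q) (be q) (ga q) (al r) (be r) (ga r) (al x) (be x) (ga x) :=
  area2_det3 q r x (erefl M) Mn.
have H i j k : (i < j < k)%N -> (k < 6)%N ->
    0 < det3 (al (p i)) (be (p i)) (ga (p i)) (al (p j)) (be (p j)) (ga (p j))
             (al (p k)) (be (p k)) (ga (p k)) <= 1.
  by move=> ijk kn; rewrite -(pmulr_rgt0 _ M0) -[X in _ && X](ler_pM2l M0)
    -D mulr1 bd.
have [a0 b0 c0] : [/\ al (p 0%N) = 1, be (p 0%N) = 0 & ga (p 0%N) = 0].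
  by split; [apply: coord1|exact: coord0r|exact: coord0l].
have [a2 b2 c2] : [/\ al (p 2%N) = 0, be (p 2%N) = 1 & ga (p 2%N) = 0].
  by split; [exact: coord0l|apply: coord1; rewrite // area2_rot|exact: coord0r].
have [a5 b5 c5] : [/\ al (p 5%N) = 0, be (p 5%N) = 0 & ga (p 5%N) = 1].
  by split; [exact: coord0r|exact: coord0l|apply: coord1; rewrite // -area2_rot].
have e1 : be (p 1%N) = 1 - al (p 1%N) - ga (p 1%N) by have := sum (p 1%N); lra.
have e3 : be (p 3%N) = 1 - al (p 3%N) - ga (p 3%N) by have := sum (p 3%N); lra.
have e4 : be (p 4%N) = 1 - al (p 4%N) - ga (p 4%N) by have := sum (p 4%N); lra.
have vv := (a0, b0, c0, a2, b2, c2, a5, b5, c5, e1, e3, e4).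
have c : - ga (p 1%N) + (- al (p 4%N) * (1 - ga (p 3%N)) + ga (p 4%N)
  * - al (p 3%N)) <= 5 / 4.
  apply: (side_caps_le R (al (p 1%N)) (- ga (p 1%N)) (- al (p 3%N))
    (ga (p 3%N)) (- al (p 4%N)) (ga (p 4%N))).
  - by have /andP[] := H 0%N 1%N 2%N isT isT; rewrite /det3 !vv; lra.
  - by have /andP[] := H 0%N 1%N 5%N isT isT; rewrite /det3 !vv; lra.
  - by have /andP[] := H 1%N 2%N 5%N isT isT; rewrite /det3 !vv; lra.
  - by have /andP[] := H 2%N 3%N 5%N isT isT; rewrite /det3 !vv; lra.
  - by have /andP[] := H 0%N 3%N 5%N isT isT; rewrite /det3 !vv; lra.
  - by have /andP[] := H 0%N 2%N 3%N isT isT; rewrite /det3 !vv; lra.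
  - by have /andP[] := H 2%N 4%N 5%N isT isT; rewrite /det3 !vv; lra.
  - by have /andP[] := H 0%N 4%N 5%N isT isT; rewrite /det3 !vv; lra.
  - by have /andP[] := H 0%N 2%N 4%N isT isT; rewrite /det3 !vv; lra.
  - by have /andP[] := H 0%N 1%N 3%N isT isT; rewrite /det3 !vv; lra.
  - by have /andP[] := H 0%N 1%N 4%N isT isT; rewrite /det3 !vv; lra.
  - by have /andP[] := H 1%N 3%N 5%N isT isT; rewrite /det3 !vv; lra.
  - by have /andP[] := H 1%N 4%N 5%N isT isT; rewrite /det3 !vv; lra.
have -> : fan_area2 p 4 =
  M * (1 - ga (p 1%N) + (- al (p 4%N) * (1 - ga (p 3%N)) + ga (p 4%N)
  * - al (p 3%N))).
  rewrite (_ : fan_area2 p 4 =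
    area2 (p 0%N) (p 1%N) (p 2%N) + area2 (p 0%N) (p 2%N) (p 5%N) +
    area2 (p 2%N) (p 3%N) (p 4%N) + area2 (p 2%N) (p 4%N) (p 5%N)).
    by rewrite !D /det3 !vv; ring.
  by rewrite /fan_area2 !big_ord_recr big_ord0 /= /area2; ring.
by rewrite mulrC ler_pM2r //; lra.
Qed.

Lemma hexagon_le_ear p : triples_bounded 6 p (area2 (p 0%N) (p 1%N) (p 2%N)) ->
  fan_area2 p 4 <= 9 / 4 * area2 (p 0%N) (p 1%N) (p 2%N).
Proof.
set M := area2 _ _ _ => bd.
have /andP[M0 _] : 0 < M <= M by apply: bd.
have Mn : M != 0 by rewrite gt_eqF.
pose al q := coord (p 1%N) (p 2%N) q M.
pose be q := coord (p 2%N) (p 0%N) q M.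
pose ga q := coord (p 0%N) (p 1%N) q M.
have sum q : al q + be q + ga q = 1 := coord_sum q Mn.
have D q r x : area2 q r x =
  M * det3 (al q) (be q) (ga q) (al r) (be r) (ga r) (al x) (be x) (ga x) :=
  area2_det3 q r x (erefl M) Mn.
have H i j k : (i < j < k)%N -> (k < 6)%N ->
    0 < det3 (al (p i)) (be (p i)) (ga (p i)) (al (p j)) (be (p j)) (ga (p j))
             (al (p k)) (be (p k)) (ga (p k)) <= 1.
  by move=> ijk kn; rewrite -(pmulr_rgt0 _ M0) -[X in _ && X](ler_pM2l M0)
    -D mulr1 bd.
have [a0 b0 c0] : [/\ al (p 0%N) = 1, be (p 0%N) = 0 & ga (p 0%N) = 0].
  by split; [apply: coord1|exact: coord0r|exact: coord0l].
have [a1 b1 c1] : [/\ al (p 1%N) = 0, be (p 1%N) = 1 & ga (p 1%N) = 0].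
  by split; [exact: coord0l|apply: coord1; rewrite // area2_rot|exact: coord0r].
have [a2 b2 c2] : [/\ al (p 2%N) = 0, be (p 2%N) = 0 & ga (p 2%N) = 1].
  by split; [exact: coord0r|exact: coord0l|apply: coord1; rewrite // -area2_rot].
have e3 : al (p 3%N) = 1 - be (p 3%N) - ga (p 3%N) by have := sum (p 3%N); lra.
have e4 : al (p 4%N) = 1 - be (p 4%N) - ga (p 4%N) by have := sum (p 4%N); lra.
have e5 : al (p 5%N) = 1 - be (p 5%N) - ga (p 5%N) by have := sum (p 5%N); lra.
have vv := (a0, b0, c0, a1, b1, c1, a2, b2, c2, e3, e4, e5).
have c : - be (p 3%N) + (ga (p 3%N) * - be (p 4%N) - ga (p 4%N) * - be (p 3%N))
  + (ga (p 4%N) * - be (p 5%N) - ga (p 5%N) * - be (p 4%N)) <= 1.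
  apply: ear_cap_le.
  - by have /andP[] := H 0%N 2%N 4%N isT isT; rewrite /det3 !vv; lra.
  - by have /andP[] := H 0%N 2%N 3%N isT isT; rewrite /det3 !vv; lra.
  - by have /andP[] := H 1%N 2%N 4%N isT isT; rewrite /det3 !vv; lra.
  - by have /andP[] := H 0%N 1%N 4%N isT isT; rewrite /det3 !vv; lra.
  - by have /andP[] := H 1%N 2%N 5%N isT isT; rewrite /det3 !vv; lra.
  - by have /andP[] := H 0%N 1%N 5%N isT isT; rewrite /det3 !vv; lra.
  - by have /andP[] := H 0%N 1%N 3%N isT isT; rewrite /det3 !vv; lra.
have -> : fan_area2 p 4 =
  M * (1 + (- be (p 3%N) + (ga (p 3%N) * - be (p 4%N) - ga (p 4%N)
  * - be (p 3%N)) + (ga (p 4%N) * - be (p 5%N) - ga (p 5%N) * - be (p 4%N)))).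
  rewrite (_ : fan_area2 p 4 =
    area2 (p 0%N) (p 1%N) (p 2%N) + area2 (p 0%N) (p 2%N) (p 3%N) +
    area2 (p 0%N) (p 3%N) (p 4%N) + area2 (p 0%N) (p 4%N) (p 5%N)).
    by rewrite !D /det3 !vv; ring.
  by rewrite /fan_area2 !big_ord_recr big_ord0 /= /area2; ring.
by rewrite mulrC ler_pM2r //; lra.
Qed.

End HexagonCases.

(** * Bounds for quadrilaterals, pentagons and hexagons *)

Section Bounds.
Variable R : realType.
Implicit Types (a b c q r x : plane R) (p : nat -> plane R) (M : R).

Definition rot6 p k := p (k.+1 %% 6)%N.
(** Reflections reverse orientation, so the numbering of the vertices has to be
    reversed as well. *)
Definition mirror q : plane R := (q.2, q.1).
Definition rev6 p k := mirror (p (5 - k)%N).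

Lemma area2_mirror a b c : area2 (mirror a) (mirror b) (mirror c) = area2 c b a.
Proof. by rewrite /area2 /mirror /=; ring. Qed.

Lemma rot6_bounded p M : triples_bounded 6 p M -> triples_bounded 6 (rot6 p) M.
Proof.
move=> bd i j k ijk k6; rewrite /rot6 (_ : (i.+1 %% 6) = i.+1)%N;
  last by rewrite modn_small; lia.
rewrite (_ : (j.+1 %% 6) = j.+1)%N; last by rewrite modn_small; lia.
have [->|k5] := eqVneq k 5%N; first by rewrite area2_rot; apply: bd; lia.
by rewrite modn_small; [apply: bd; lia | lia].
Qed.

Lemma rot6_fan_area2 p : fan_area2 (rot6 p) 4 = fan_area2 p 4.
Proof. by rewrite /fan_area2 !big_ord_recr !big_ord0 /= /rot6 /= /area2; ring. Qed.

Lemma rev6_bounded p M : triples_bounded 6 p M -> triples_bounded 6 (rev6 p) M.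
Proof. by move=> bd i j k ijk k6; rewrite area2_mirror; apply: bd; lia. Qed.

Lemma rev6_fan_area2 p : fan_area2 (rev6 p) 4 = fan_area2 p 4.
Proof. by rewrite /fan_area2 !big_ord_recr !big_ord0 /= /rev6 /= /area2 /mirror
  /=; ring. Qed.

(** The 20 triples of vertices fall into 6 ears, 2 alternate triangles, and
    12 triangles having exactly one side in common with the hexagon.  These
    last ones form two orbits under rotation, exchanged by reflection. *)
Lemma hexagon_le p M i j k : triples_bounded 6 p M -> (i < j < k)%N -> (k < 6)%N ->
  area2 (p i) (p j) (p k) = M -> fan_area2 p 4 <= 9 / 4 * M.
Proof.
move=> bd ijk k6 MD.
have rots (t : nat) : triples_bounded 6 (iter t rot6 p) M.
  by elim: t => // t IH; apply: rot6_bounded.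
have rotf (t : nat) : fan_area2 (iter t rot6 p) 4 = fan_area2 p 4.
  by elim: t => // t <-; rewrite /= rot6_fan_area2.
have t1 (t : nat) : let s := iter t rot6 p in
    area2 (s 0%N) (s 2%N) (s 4%N) = M -> fan_area2 p 4 <= 9 / 4 * M.
  by move=> s e; rewrite -e -(rotf t); apply: hexagon_le_alternate;
    rewrite -/s e; apply: rots.
have t2 (t : nat) : let s := iter t rot6 p in
    area2 (s 0%N) (s 2%N) (s 5%N) = M -> fan_area2 p 4 <= 9 / 4 * M.
  by move=> s e; rewrite -e -(rotf t); apply: hexagon_le_side; rewrite -/s e;
    apply: rots.
have t2' (t : nat) : let s := iter t rot6 p in
    area2 (s 0%N) (s 3%N) (s 5%N) = M -> fan_area2 p 4 <= 9 / 4 * M.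
  move=> s e; rewrite -(rotf t) -rev6_fan_area2 -/s.
  have e' : area2 (rev6 s 0%N) (rev6 s 2%N) (rev6 s 5%N) =
    M by rewrite area2_mirror.
  by rewrite -e'; apply: hexagon_le_side; rewrite e'; apply/rev6_bounded/rots.
have t3 (t : nat) : let s := iter t rot6 p in
    area2 (s 0%N) (s 1%N) (s 2%N) = M -> fan_area2 p 4 <= 9 / 4 * M.
  by move=> s e; rewrite -e -(rotf t); apply: hexagon_le_ear; rewrite -/s e;
    apply: rots.
case: k k6 ijk MD => [|[|[|[|[|[|k]]]]]] // _; case: j => [|[|[|[|[|[|j]]]]]];
  rewrite ?andbF //; case: i => [|[|[|[|[|[|i]]]]]] // _ MD.
- by apply: (t3 0%N).
- by apply: (t2 1%N); rewrite area2_rot.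
- by apply: (t2' 3%N); rewrite area2_rot area2_rot.
- by apply: (t3 1%N).
- by apply: (t2' 1%N); rewrite area2_rot.
- by apply: (t1 0%N).
- by apply: (t2 2%N); rewrite area2_rot.
- by apply: (t2 4%N); rewrite area2_rot area2_rot.
- by apply: (t2' 4%N); rewrite area2_rot area2_rot.
- by apply: (t3 2%N).
- by apply: (t3 5%N); rewrite area2_rot area2_rot.
- by apply: (t2 0%N).
- by apply: (t2' 2%N); rewrite area2_rot.
- by apply: (t2' 0%N).
- by apply: (t1 1%N).
- by apply: (t2 3%N); rewrite area2_rot.
- by apply: (t3 4%N); rewrite area2_rot.
- by apply: (t2 5%N); rewrite area2_rot area2_rot.
- by apply: (t2' 5%N); rewrite area2_rot area2_rot.
- by apply: (t3 3%N).
Qed.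

Lemma quadrilateral_le p M : triples_bounded 4 p M -> fan_area2 p 2 <= 2 * M.
Proof.
move=> bd; rewrite /fan_area2 !big_ord_recr big_ord0 /= add0r.
have /andP[_ ?] := bd 0%N 1%N 2%N isT isT;
  have /andP[_ ?] := bd 0%N 2%N 3%N isT isT; lra.
Qed.

Lemma pentagon_le p M : triples_bounded 5 p M -> fan_area2 p 3 <= Num.sqrt 5 * M.
Proof.
move=> bd; have /andP[h1 h2] := bd 0%N 1%N 2%N isT isT.
have nn i j k : (i < j < k)%N -> (k < 5)%N -> 0 <= area2 (p i) (p j) (p k) <= M.
  by move=> ijk k5; have /andP[/ltW -> ->] := bd i j k ijk k5.
pose S := fan_area2 p 3.
have SE : S = area2 (p 0%N) (p 1%N) (p 2%N) + area2 (p 0%N) (p 2%N) (p 3%N)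
  + area2 (p 0%N) (p 3%N) (p 4%N).
  by rewrite /S /fan_area2 !big_ord_recr big_ord0 /= add0r.
apply: (@gauss_pentagon_le _ S (area2 (p 4) (p 0) (p 1)) (area2 (p 0) (p 1)
  (p 2)) (area2 (p 1) (p 2) (p 3))
  (area2 (p 2) (p 3) (p 4)) (area2 (p 3) (p 4) (p 0)))%N.
- exact: lt_le_trans h1 h2.
- by rewrite SE /area2; ring.
- rewrite (_ : _ - _ - _ = area2 (p 1%N) (p 3%N) (p 4%N));
    [exact: nn | by rewrite SE /area2; ring].
- rewrite (_ : _ - _ - _ = area2 (p 0%N) (p 2%N) (p 4%N));
    [exact: nn | by rewrite SE /area2; ring].
- rewrite (_ : _ - _ - _ = area2 (p 0%N) (p 1%N) (p 3%N));
    [exact: nn | by rewrite SE /area2; ring].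
- rewrite (_ : _ - _ - _ = area2 (p 1%N) (p 2%N) (p 4%N));
    [exact: nn | by rewrite SE /area2; ring].
- rewrite (_ : _ - _ - _ = area2 (p 0%N) (p 2%N) (p 3%N));
    [exact: nn | by rewrite SE /area2; ring].
Qed.

End Bounds.

(** * The largest triangle *)

Section LargestTriangle.
Variable R : realType.
Implicit Types (a b c q r x : plane R) (p : nat -> plane R) (M : R).

Lemma polygon_ccw n (P : set (plane R)) : (2 < n)%N -> convex_polygon n P ->
  exists2 p, ccw n p & P = ngon n p.
Proof.
move=> n2 [v [cv ->]]; have [p cp e] := ccw_ordering cv (ltn_trans (ltn0Sn 1) n2).
by exists p => //; rewrite /ngon e.
Qed.

Lemma area_ngon n p : ccw n.+3 p -> area (ngon n.+3 p) = (fan_area2 p n.+1 / 2)%:E.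
Proof. by move=> cp; rewrite ngonE // (area_fan cp). Qed.

Lemma area_triangle_le (P T : set (plane R)) M :
  (forall q r x, P q -> P r -> P x -> area2 q r x <= M) ->
  triangle T -> T `<=` P -> exists2 t : R, area T = t%:E & 0 <= t <= M / 2.
Proof.
move=> hM /polygon_ccw -/(_ isT) [p cp ->] TP; exists (fan_area2 p 1 / 2);
  first exact: area_ngon.
have D : 0 < area2 (p 0%N) (p 1%N) (p 2%N) by apply: cp.
rewrite /fan_area2 big_ord1; apply/andP; split; first by apply: divr_ge0 => //;
  exact: ltW.
have mem k : (k < 3)%N -> P (p k) by move=> k3; apply: TP; apply: sub_hull;
  exists k.
by rewrite ler_pM2r //; apply: hM; apply: mem.
Qed.

Lemma triples_bounded_ngon n p M : 0 <= M -> triples_bounded n p M ->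
  forall q r x, ngon n p q -> ngon n p r -> ngon n p x -> area2 q r x <= M.
Proof.
move=> M0 bd; apply: hull_area2_le => q r x [a /= an <-] [b /= bn <-] [c /= cn <-].
have bd' i j k : (i < j < k)%N -> (k < n)%N -> - M <= area2 (p i) (p j) (p k) <= M.
  by move=> h1 h2; have /andP[h3 ->] := bd _ _ _ h1 h2; rewrite andbT; lra.
have [<-|ab] := eqVneq a b; first by rewrite (_ : area2 _ _ _ = 0) // /area2; ring.
have [<-|ac] := eqVneq a c; first by rewrite (_ : area2 _ _ _ = 0) // /area2; ring.
have [<-|bc] := eqVneq b c; first by rewrite (_ : area2 _ _ _ = 0) // /area2; ring.
have [ab'|ba] := ltnP a b; have [ac'|ca] := ltnP a c; have [bc'|cb] := ltnP b c.
- by have /andP[] := bd' a b c ltac:(lia) cn.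
- by rewrite area2_swapr; have := bd' a c b ltac:(lia) bn; lra.
- by lia.
- by rewrite area2_rot; have /andP[] := bd' c a b ltac:(lia) bn.
- by rewrite area2_swap; have := bd' b a c ltac:(lia) cn; lra.
- by lia.
- by rewrite -area2_rot; have /andP[] := bd' b c a ltac:(lia) an.
- by rewrite area2_rot area2_swapr; have := bd' c b a ltac:(lia) an; lra.
Qed.

Lemma max_triple n p : ccw n.+3 p ->
  exists M i j k, [/\ (i < j < k)%N, (k < n.+3)%N,
  area2 (p i) (p j) (p k) = M, triples_bounded n.+3 p M & forall q r x,
    ngon n.+3 p q -> ngon n.+3 p r -> ngon n.+3 p x -> area2 q r x <= M].
Proof.
move=> cp.
pose T (t : 'I_n.+3 * 'I_n.+3 * 'I_n.+3) := area2 (p t.1.1) (p t.1.2) (p t.2).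
pose o (k : nat) : 'I_n.+3 := inord k.
pose inc (t : 'I_n.+3 * 'I_n.+3 * 'I_n.+3) := (t.1.1 < t.1.2 < t.2)%N.
have inc0 : inc (o 0%N, o 1%N, o 2%N) by rewrite /inc /o /= !inordK.
case: (Order.TotalTheory.arg_maxP T inc0) => -[[i j] k] ijk hmax.
have bd : triples_bounded n.+3 p (area2 (p i) (p j) (p k)).
  move=> a b c abc cn; rewrite cp //=.
  have := hmax (o a, o b, o c); rewrite /inc /T /o /= !inordK //; [exact|lia..].
exists (area2 (p i) (p j) (p k)), i, j, k; split => //.
set M := area2 _ _ _ in bd *.
have M0 : 0 <= M by apply/ltW/cp.
exact: triples_bounded_ngon.
Qed.

Lemma convex_polygon3 a b c : 0 < area2 a b c -> convex_polygon 3 (tri a b c).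
Proof.
move=> D; pose p k := nth a [:: a; b; c] k.
have cp : ccw 3 p.
  move=> i j k; case: k => [|[|[|k]]] //; case: j => [|[|j]];
    rewrite ?andbF //; by case: i.
have := ngon_convex_polygon cp; rewrite ngonE // /fan big_ord1 /=. exact.
Qed.

Lemma max_triangle_area_ngon n p M : ccw n.+3 p ->
   (exists i j k, [/\ (i < j < k)%N, (k < n.+3)%N & area2 (p i) (p j) (p k) = M]) ->
   (forall q r x, ngon n.+3 p q -> ngon n.+3 p r -> ngon n.+3 p x ->
     area2 q r x <= M) ->
   max_triangle_area (ngon n.+3 p) (M / 2)%:E.
Proof.
move=> cp [i [j [k [ijk kn MD]]]] hM.
have D : 0 < area2 (p i) (p j) (p k) by apply: cp.
split.
  exists (tri (p i) (p j) (p k)); last by rewrite area_tri // MD.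
  split; first exact: convex_polygon3.
  apply: tri_sub => //; first exact: hull_convex.
  - by apply: sub_hull; exists i => //=; lia.
  - by apply: sub_hull; exists j => //=; lia.
  - by apply: sub_hull; exists k.
by move=> _ [T [tT TP] <-];
  have [t -> /andP[_ ?]] := area_triangle_le hM tT TP; rewrite lee_fin.
Qed.

Lemma fan_area2_le_gamma n p M i j k : n \in [:: 3; 4; 5;
  6]%N -> triples_bounded n p M ->
  (i < j < k)%N -> (k < n)%N -> area2 (p i) (p j) (p k) = M ->
  fan_area2 p (n - 2) <= gamma R n * M.
Proof.
rewrite !inE => /or4P[] /eqP -> bd ijk kn MD; rewrite /gamma.
- have /andP[_ ?] := bd 0%N 1%N 2%N isT isT; by rewrite /fan_area2 big_ord1 mul1r.
- exact: quadrilateral_le.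
- exact: pentagon_le.
- exact: hexagon_le ijk kn MD.
Qed.

Lemma area_bound_gamma n : n \in [:: 3; 4; 5; 6]%N -> area_bound n (gamma R n).
Proof.
move=> hn; have n2 : (2 < n)%N by move: hn; rewrite !inE => /or4P[] /eqP ->.
move=> P /(polygon_ccw n2) [p cp ->].
have nE : n = (n - 3).+3 by lia.
rewrite nE in cp *.
have [M [i [j [k [ijk kn MD bd hM]]]]] := max_triple cp.
exists (M / 2)%:E; first by apply: max_triangle_area_ngon => //; exists i, j, k.
rewrite area_ngon // -EFinM lee_fin mulrA ler_pM2r //.
have := @fan_area2_le_gamma n p M i j k hn; rewrite {1 2}nE => /(_ bd ijk kn MD).
by rewrite (_ : (n - 2 = (n - 3).+1)%N) -?nE //; lia.
Qed.

(** The example only has to be given by its vertices: both the area of the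
    polygon and the bound on the triangles inside it are read off them. *)
Lemma not_area_bound n p M (g c : R) : triples_bounded n.+3 p M ->
  fan_area2 p n.+1 = g * M -> 0 < g -> c < g -> ~ area_bound n.+3 c.
Proof.
move=> bd S g0 cg; have cp : ccw n.+3 p by move=> i j k h1 h2;
  have /andP[] := bd i j k h1 h2.
have M0 : 0 < M by have /andP[h] := bd 0%N 1%N 2%N isT isT; apply: lt_le_trans.
move=> /(_ _ (ngon_convex_polygon cp)) [m [[T [tT TP] <-]] _].
have [t -> /andP[t0 tM]] :=
  area_triangle_le (triples_bounded_ngon (ltW M0) bd) tT TP.
rewrite area_ngon // S -EFinM lee_fin; apply/negP; rewrite -ltNge.
have [c0|c0] := leP c 0.
  apply: (@le_lt_trans _ _ 0); first exact: mulr_le0_ge0.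
  by rewrite divr_gt0 // mulr_gt0.
apply: (@le_lt_trans _ _ (c * (M / 2))); first by rewrite ler_pM2l.
by rewrite mulrA ltr_pM2r // ltr_pM2r.
Qed.

(** * Sharpness *)

Definition pts (s : seq (plane R)) k : plane R := nth (0, 0) s k.

Lemma triangle_sharp (c : R) : c < 1 -> ~ area_bound 3 c.
Proof.
apply: (@not_area_bound 0 (pts [:: (0, 0); (1, 0); (0, 1)]) 1) => //.
  move=> i j k + kn; case: k kn => [|[|[|k]]] // _; case: j => [|[|[|j]]];
    rewrite ?andbF //;
  case: i => [|[|i]] // _; rewrite /area2 /pts /=; lra.
by rewrite /fan_area2 big_ord1 /area2 /pts /=; lra.
Qed.

Lemma quadrilateral_sharp (c : R) : c < 2 -> ~ area_bound 4 c.
Proof.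
apply: (@not_area_bound 1 (pts [:: (0, 0); (1, 0); (1, 1); (0, 1)]) 1) => //.
  move=> i j k + kn; case: k kn => [|[|[|[|k]]]] // _;
    case: j => [|[|[|[|j]]]]; rewrite ?andbF //;
  case: i => [|[|[|i]]] // _; rewrite /area2 /pts /=; lra.
by rewrite /fan_area2 !big_ord_recr big_ord0 /area2 /pts /=; lra.
Qed.

(** An affinely regular pentagon with g the inverse of the golden ratio: the
    ears have area g and all other triangles have area 1, in units where the
    pentagon has area 1 + 2 g, the square root of 5. *)
Lemma pentagon_sharp (c : R) : c < Num.sqrt 5 -> ~ area_bound 5 c.
Proof.
pose g : R := (Num.sqrt 5 - 1) / 2.
have s5 : Num.sqrt 5 ^+ 2 = 5 :> R by rewrite sqr_sqrtr.
have s2 : 2 < Num.sqrt 5 :> R by rewrite -(ltr_pXn2r (n :=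
  2)) ?nnegrE ?sqrtr_ge0 // s5; lra.
have s3 : Num.sqrt 5 < 3 :> R by rewrite -(ltr_pXn2r (n :=
  2)) ?nnegrE ?sqrtr_ge0 // s5; lra.
have gg : g * g = 1 - g by rewrite /g; lra.
have g0 : 0 < g < 1 by rewrite /g; lra.
have gE : Num.sqrt 5 = 1 + 2 * g by rewrite /g; field.
rewrite gE; move: (g) gg g0 => {s5 s2 s3 gE} {}g gg g0.
apply: (@not_area_bound 2 (pts [:: (0, 0); (1, - g); (1, 0); (0, 1);
  (- g, 1)]) 1); last by lra.
  move=> i j k + kn; case: k kn => [|[|[|[|[|k]]]]] // _;
    case: j => [|[|[|[|[|j]]]]]; rewrite ?andbF //;
  case: i => [|[|[|[|i]]]] // _; rewrite /area2 /pts /=; lra.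
by rewrite /fan_area2 !big_ord_recr big_ord0 /area2 /pts /=; lra.
Qed.

(** A case of equality in side_caps_le and in three_caps_le, at h = 1/2 in the
    family of binding configurations: the chords p0 p1, p5 p2 and p4 p3 are
    parallel, in the proportion 4 : 6 : 1, and the largest triangles are
    p0 p1 p3, p0 p1 p4, p0 p2 p4, p0 p2 p5, p1 p2 p5 and p1 p3 p5. *)
Lemma hexagon_sharp (c : R) : c < 9 / 4 -> ~ area_bound 6 c.
Proof.
apply: (@not_area_bound 3 (pts [:: (-4, 0); (4, 0); (6, 2); (1, 3); (-1, 3);
  (-6, 2)]) 24); last by lra.
  move=> i j k + kn; case: k kn => [|[|[|[|[|[|k]]]]]] // _;
    case: j => [|[|[|[|[|[|j]]]]]]; rewrite ?andbF //;
  case: i => [|[|[|[|[|i]]]]] // _; rewrite /area2 /pts /=; lra.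
by rewrite /fan_area2 !big_ord_recr big_ord0 /area2 /pts /=; lra.
Qed.

End LargestTriangle.

Theorem proposition1p2 (R : realType) (n : nat) (hn : n \in [:: 3; 4; 5; 6]%N) :
  area_bound n (gamma R n) /\
  (forall c : R, c < gamma R n -> ~ area_bound n c).
Proof.
split; first exact: area_bound_gamma.
move: hn; rewrite !inE => /or4P[] /eqP -> c.
- exact: triangle_sharp.
- exact: quadrilateral_sharp.
- exact: pentagon_sharp.
- exact: hexagon_sharp.
Qed.
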